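(* Let $(\xi_{i,j})_{i,j=1}^\infty$ be independent copies of a random variable $\xi$ with $\mathbb{E}\xi=0$, $\mathbb{E}\xi^2=1$ and $\mathbb{E}\xi^4<\infty$. For $d\in\mathbb{N}$ and $i\in\mathbb{N}$ let $X_i^{(d)}:=(\xi_{i,1},\dots,\xi_{i,d})/\sqrt d\in\mathbb{R}^d$, and let $S_k^{(d)}:=X_1^{(d)}+\dots+X_k^{(d)}$. Let $n=n(d)$ be an arbitrary sequence of positive integers such that $n(d)\to\infty$ as $d\to\infty$. Then, as $d\to\infty$, $$\frac{\|S_n^{(d)}\|^2-n}{\sqrt{2n^2/d}}\ \overset{w}{\longrightarrow}\ \mathrm{N}(0,1).$$
   Context: $\|\cdot\|$ is the Euclidean norm, $\overset{w}{\longrightarrow}$ denotes convergence in distribution, and $\mathrm{N}(0,\sigma^2)$ is the centered normal distribution with variance $\sigma^2$. *)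

(* Defs.v *)
From HB Require Import structures.
From mathcomp Require Import all_boot all_order all_algebra finmap.
From mathcomp Require Import all_classical all_reals all_analysis.
From mathcomp Require Import measurable_realfun.

Set Implicit Arguments.
Unset Strict Implicit.
Unset Printing Implicit Defensive.

Import Order.TTheory GRing.Theory Num.Theory.
Import numFieldNormedType.Exports.

Local Open Scope classical_set_scope.
Local Open Scope ring_scope.

Definition mutually_independent (d : measure_display) (T : measurableType d)
    (R : realType) (P : probability T R) (I : choiceType)
    (X : I -> {RV P >-> R}) : Prop :=
  forall (J : {fset I}) (A : I -> set R),
    (forall i, i \in J -> measurable (A i)) ->
    P (\bigcap_(i in [set` J]) (X i @^-1` A i)) =
    (\prod_(i <- J) P (X i @^-1` A i))%E.
Arguments mutually_independent {d T R} P {I} X.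

Definition same_distribution (d d' : measure_display) (T : measurableType d)
    (T' : measurableType d') (R : realType) (P : probability T R)
    (P' : probability T' R) (X : {RV P >-> R}) (Y : {RV P' >-> R}) : Prop :=
  forall A : set R, measurable A -> distribution P X A = distribution P' Y A.
Arguments same_distribution {d d' T T' R} P P' X Y.

Definition independent_copies (d d' : measure_display) (T : measurableType d)
    (T' : measurableType d') (R : realType) (P : probability T R)
    (P' : probability T' R) (X : nat -> nat -> {RV P >-> R})
    (Y : {RV P' >-> R}) : Prop :=
  mutually_independent P (fun ij : nat * nat => X ij.1 ij.2) /\
  forall i j, same_distribution P P' (X i j) Y.
Arguments independent_copies {d d' T T' R} P P' X Y.

Definition cvg_in_distribution (d : measure_display) (T : measurableType d)
    (R : realType) (P : probability T R) (Y : nat -> {RV P >-> R})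
    (mu : probability (measurableTypeR R) R) : Prop :=
  forall f : R -> R, continuous f -> bounded_fun f ->
    ('E_P[f \o Y k] @[k --> \oo] --> 'E_mu[f])%E.
Arguments cvg_in_distribution {d T R} P Y mu.

(* The library norm `|v| on row vectors is the sup norm. *)
Definition enorm (R : realType) (d : nat) (v : 'rV[R]_d) : R :=
  Num.sqrt (\sum_(j < d) v ord0 j ^+ 2).

Section RandomWalk.
Context (disp : measure_display) (T : measurableType disp) (R : realType).
Context (P : probability T R) (xi : nat -> nat -> {RV P >-> R}).

(* Indices start at 0: the increments are X_0, X_1, and so on, the coordinates
   of each are xi i 0, ..., xi i (d - 1), and S_k = X_0 + ... + X_(k-1). *)
Definition step (d i : nat) (w : T) : 'rV[R]_d :=
  (Num.sqrt d%:R)^-1 *: \row_(j < d) xi i j w.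

Definition walk (d k : nat) (w : T) : 'rV[R]_d := \sum_(i < k) step d i w.

Definition normalized_sqnorm (d n : nat) (w : T) : R :=
  (enorm (walk d n w) ^+ 2 - n%:R) / Num.sqrt (2 * n%:R ^+ 2 / d%:R).

Lemma measurable_normalized_sqnorm d n :
  measurable_fun setT (normalized_sqnorm d n).
Proof.
have mcoord (j : 'I_d) : measurable_fun setT (fun w => walk d n w ord0 j).
  under eq_fun do rewrite summxE.
  apply: measurable_sum => i; under eq_fun do rewrite !mxE.
  exact: measurable_funM.
apply: measurable_funM => //; apply: measurable_funB => //.
have -> : (fun w => enorm (walk d n w) ^+ 2) =
    (fun w => \sum_(j < d) walk d n w ord0 j ^+ 2).
  by apply/funext => w; rewrite sqr_sqrtr// sumr_ge0// => j _; exact: sqr_ge0.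
by apply: measurable_sum => j; exact: measurable_funX.
Qed.

HB.instance Definition _ d n := isMeasurableFun.Build _ _ T R
  (normalized_sqnorm d n) (measurable_normalized_sqnorm d n).

End RandomWalk.

(* Main.v *)
(** Put T = n^(-1/2) * sum_i xi_ij for a fixed coordinate j. The normalized squared
    norm is the sum over j < d of the i.i.d. variables (T^2 - 1) / sqrt (2 d), so a
    Lindeberg central limit theorem for arrays with i.i.d. rows applies once the
    Lindeberg condition is checked, that is, once T^4 is uniformly integrable in n.
    The same limit theorem, applied to the columns, gives T -> N(0, 1), while
    E T^4 -> 3 = E N(0, 1)^4 by direct computation; together these give the uniform
    integrability.

    The array theorem is proved by swapping summands for Gaussian ones (Lindeberg,
    Trotter), with test functions smoothed by three successive averagings
    f |-> h^-1 * int_x^(x+h) f, and with the error of a swap measured by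
    min (y^2, |y|^3). *)

From HB Require Import structures.
Require Import Defs.
From mathcomp Require Import all_boot all_order all_algebra finmap.
From mathcomp Require Import all_classical all_reals all_analysis.
From mathcomp Require Import measurable_realfun ring lra.

Set Implicit Arguments.
Unset Strict Implicit.
Unset Printing Implicit Defensive.

Import Order.TTheory GRing.Theory Num.Theory.
Import numFieldNormedType.Exports.

Local Open Scope classical_set_scope.
Local Open Scope ring_scope.

(** * Integrals and convolution powers *)

(** Only four moments of [xi] are available, so [T^2] has bounded variance but no higher moment, and
    Lyapunov's condition cannot be used for the rows. Hence the price [min (y^2, |y|^3)] of a swap:
    on a bounded range of [T] the cubic term gains a factor [d^(-1/2)], and beyond that range the
    quadratic term costs only a tail of [T^4]. Since n(d) and d are not tied to each other, the law
    of [T] varies with [d], and this tail must be controlled along the whole sequence.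

    Independence serves only to identify the law of the normalized squared norm as a convolution
    power of a law on the line. The limit theorems are then statements about convolution powers, and
    no probability space carrying both the given and the Gaussian summands has to be built. Three
    averagings are used because each gains one derivative and the cubic Taylor bound asks for
    three. *)

Notation intg mu f := (integrable mu setT (EFin \o f)).

Section integral_helpers.
Context (d : measure_display) (T : measurableType d) (R : realType).
Implicit Types (mu : probability T R) (f g : T -> R).

Lemma intg_le mu f g : measurable_fun setT f -> (forall x, `|f x| <= g x) ->
  intg mu g -> intg mu f.
Proof.
move=> mf fg; apply: le_integrable => //; first exact/measurable_EFinP.
by move=> x _ /=; rewrite lee_fin (le_trans (fg x))// ler_norm.
Qed.

Lemma intg_cst mu c : intg mu (cst c).
Proof. exact: finite_measure_integrable_cst. Qed.

Lemma intg_bounded mu f M : measurable_fun setT f -> (forall x, `|f x| <= M) ->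
  intg mu f.
Proof. by move=> mf fM; apply: intg_le (intg_cst mu M). Qed.

Lemma intgD mu f g : intg mu f -> intg mu g -> intg mu (fun x => f x + g x).
Proof. by move=> intf intgg; exact: (integrableD _ intf intgg). Qed.

Lemma intgN mu f : intg mu f -> intg mu (fun x => - f x).
Proof. by move=> intf; exact: integrableN intf. Qed.

Lemma intgB mu f g : intg mu f -> intg mu g -> intg mu (fun x => f x - g x).
Proof. by move=> intf intgg; apply: intgD => //; exact: intgN. Qed.

Lemma intgZ mu c f : intg mu f -> intg mu (fun x => c * f x).
Proof. by move=> intf; exact: (integrableZl _ c intf). Qed.

Lemma intg_measurable mu f : intg mu f -> measurable_fun setT f.
Proof. by move=> /measurable_int /measurable_EFinP. Qed.

Lemma intg_norm mu f : intg mu f -> intg mu (fun x => `|f x|).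
Proof. exact: integrable_norm. Qed.

Lemma mean_cst mu c : \int[mu]_x c = c.
Proof. by rewrite Rintegral_cst// [X in fine X]probability_setT mulr1. Qed.

Lemma meanD mu f g : intg mu f -> intg mu g ->
  \int[mu]_x (f x + g x) = \int[mu]_x f x + \int[mu]_x g x.
Proof. by move=> *; rewrite RintegralD. Qed.

Lemma meanB mu f g : intg mu f -> intg mu g ->
  \int[mu]_x (f x - g x) = \int[mu]_x f x - \int[mu]_x g x.
Proof. by move=> *; rewrite RintegralB. Qed.

Lemma meanZ mu c f : intg mu f -> \int[mu]_x (c * f x) = c * \int[mu]_x f x.
Proof. by move=> *; rewrite RintegralZl. Qed.

Lemma le_mean mu f g : intg mu f -> intg mu g -> (forall x, f x <= g x) ->
  \int[mu]_x f x <= \int[mu]_x g x.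
Proof. by move=> intf intgg fg; apply: le_Rintegral. Qed.

Lemma le_norm_mean mu f g : intg mu f -> intg mu g ->
  (forall x, `|f x| <= g x) -> `|\int[mu]_x f x| <= \int[mu]_x g x.
Proof.
move=> intf intgg fg; apply: le_trans (le_normr_Rintegral _ intf) _ => //.
by apply: le_mean => //; exact: intg_norm.
Qed.

Lemma le_norm_mean_cst mu f M : measurable_fun setT f ->
  (forall x, `|f x| <= M) -> `|\int[mu]_x f x| <= M.
Proof.
move=> mf fM; rewrite -[leRHS](mean_cst mu).
by apply: le_norm_mean => //; [exact: intg_bounded fM|exact: intg_cst].
Qed.

Lemma eq_law_mean (mu nu : probability T R) f :
  (forall A, measurable A -> mu A = nu A) -> \int[mu]_x f x = \int[nu]_x f x.
Proof. by move=> e; congr fine; apply: eq_measure_integral => A mA _; exact: e. Qed.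

Lemma EFin_mean mu f : intg mu f ->
  (\int[mu]_x (f x)%:E)%E = (\int[mu]_x f x)%:E.
Proof. by move=> intf; rewrite /Rintegral fineK//; exact: integrable_fin_num. Qed.

Lemma intg_sum mu (I : Type) (r : seq I) (F : I -> T -> R) :
  (forall i, intg mu (F i)) -> intg mu (fun x => \sum_(i <- r) F i x).
Proof.
move=> iF; elim: r => [|i r IH].
  by under eq_fun do rewrite big_nil; exact: intg_cst.
by under eq_fun do rewrite big_cons; exact: intgD.
Qed.

Lemma mean_sum mu (I : Type) (r : seq I) (F : I -> T -> R) :
  (forall i, intg mu (F i)) ->
  \int[mu]_x (\sum_(i <- r) F i x) = \sum_(i <- r) \int[mu]_x F i x.
Proof.
move=> iF; elim: r => [|i r IH].
  by under eq_Rintegral do rewrite big_nil; rewrite mean_cst big_nil.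
under eq_Rintegral do rewrite big_cons.
by rewrite meanD// ?IH ?big_cons//; exact: intg_sum.
Qed.

End integral_helpers.

(** Comparing [|X|] with 1 gives [|X|^m <= 1 + X^(2n)]; the even exponent makes the dominating
    function nonnegative. *)
Lemma intg_pow_le (d : measure_display) (T : measurableType d) (R : realType)
    (mu : probability T R) (X : T -> R) m n : measurable_fun setT X ->
  (m <= n.*2)%N -> intg mu (fun x => X x ^+ n.*2) -> intg mu (fun x => X x ^+ m).
Proof.
move=> mX mn iX; apply: (@intg_le _ _ _ _ _ (fun x => 1 + X x ^+ n.*2)).
- exact: measurable_funX.
- move=> x; rewrite normrX -[X in _ + X]ger0_norm; last first.
    by rewrite -muln2 mulnC exprM exprn_ge0// sqr_ge0.
  rewrite normrX; have [x1|x1] := leP `|X x| 1.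
    by rewrite (@le_trans _ _ 1) ?exprn_ile1// lerDl exprn_ge0.
  by rewrite (le_trans (ler_weXn2l (ltW x1) mn))// lerDr.
- by apply: intgD => //; exact: intg_cst.
Qed.

Section distribution_mean.
Context (d d' : measure_display) (T : measurableType d) (T' : measurableType d').
Context (R : realType) (mu : probability T R) (X : {mfun T >-> T'}).
Implicit Type f : T' -> R.

Lemma intg_distribution f : measurable_fun setT f -> intg mu (f \o X) ->
  intg (distribution mu X) f.
Proof.
move=> mf intf; apply: integrable_pushforward => //.
exact/measurable_EFinP.
Qed.

Lemma mean_distribution f : measurable_fun setT f -> intg mu (f \o X) ->
  \int[distribution mu X]_y f y = \int[mu]_x f (X x).
Proof.
move=> mf intf; congr fine; rewrite integral_distribution//.
exact/measurable_EFinP.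
Qed.

End distribution_mean.

(** * Convolution of laws on the line and its moments *)

Section Convolution.
Context {R : realType}.
Local Notation law := (probability (measurableTypeR R) R).
Implicit Types (a b : law) (h : R -> R).

Definition add_pair (p : measurableTypeR R * measurableTypeR R) :
  measurableTypeR R := p.1 + p.2.

Lemma measurable_add_pair : measurable_fun setT add_pair.
Proof. by apply: measurable_funD. Qed.

HB.instance Definition _ := isMeasurableFun.Build _ _ _ _ add_pair
  measurable_add_pair.

Definition convol a b : law := distribution (a \x b)%E add_pair.

Fixpoint convoln a n : law :=
  if n is m.+1 then convol (convoln a m) a else \d_(0 : measurableTypeR R).

Lemma intg_convol a b h : measurable_fun setT h ->
  intg (a \x b)%E (fun p => h (p.1 + p.2)) -> intg (convol a b) h.
Proof. by move=> mh ih; exact: intg_distribution. Qed.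

Lemma mean_prod a b (h : R * R -> R) : intg (a \x b)%E h ->
  (forall x, intg b (fun y => h (x, y))) ->
  \int[(a \x b)%E]_p h p = \int[a]_x \int[b]_y h (x, y).
Proof.
move=> ih ihx; rewrite /Rintegral -integral12_prod_meas1//.
congr fine; apply: eq_integral => x _.
by rewrite /fubini_F /= EFin_mean.
Qed.

Lemma mean_prod_swap a b (h : R * R -> R) : intg (a \x b)%E h ->
  (forall y, intg a (fun x => h (x, y))) ->
  \int[(a \x b)%E]_p h p = \int[b]_y \int[a]_x h (x, y).
Proof.
move=> ih ihx; rewrite /Rintegral -integral21_prod_meas1//.
congr fine; apply: eq_integral => x _.
by rewrite /fubini_G /= EFin_mean.
Qed.

(** By Tonelli the integral of the norm factors into two finite means. *)
Lemma intg_prod_mul a b (f g : R -> R) : intg a f -> intg b g ->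
  intg (a \x b)%E (fun p => f p.1 * g p.2).
Proof.
move=> ia ib.
have mfg : measurable_fun setT (fun p : measurableTypeR R * measurableTypeR R => f p.1 * g p.2).
  apply: measurable_funM.
    by apply: measurableT_comp => //; exact: intg_measurable ia.
  by apply: measurableT_comp => //; exact: intg_measurable ib.
apply/integrable12ltyP; first exact/measurable_EFinP.
rewrite (_ : (\int[_]_x _)%E = (\int[a]_x (`|f x| * \int[b]_y `|g y|)%:E)%E).
  rewrite EFin_mean; first exact: ltry.
  under eq_fun do rewrite mulrC.
  by apply: intgZ; exact: intg_norm.
apply: eq_integral => x _.
rewrite -meanZ; last exact: intg_norm.
rewrite -EFin_mean; last by apply: intgZ; exact: intg_norm.
by apply: eq_integral => y _ /=; rewrite normrM.
Qed.

Lemma mean_prod_mul a b (f g : R -> R) : intg a f -> intg b g ->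
  \int[(a \x b)%E]_p (f p.1 * g p.2) = (\int[a]_x f x) * (\int[b]_x g x).
Proof.
move=> ia ib; rewrite mean_prod//=; first last.
- by move=> x; apply: intgZ.
- exact: intg_prod_mul.
under eq_Rintegral do rewrite meanZ// mulrC.
by rewrite meanZ// mulrC.
Qed.

Section bounded.
Context (a b : law) (h : R -> R) (M : R).
Hypotheses (mh : measurable_fun setT h) (hM : forall x, `|h x| <= M).

Let mhD : measurable_fun setT
  (fun p : measurableTypeR R * measurableTypeR R => h (p.1 + p.2)).
Proof. by apply: (measurableT_comp mh); exact: measurable_add_pair. Qed.

Let ihD : intg (a \x b)%E (fun p => h (p.1 + p.2)).
Proof. exact: (@intg_bounded _ _ _ _ _ M). Qed.

Lemma intg_bounded_shift (c : law) x : intg c (fun y => h (x + y)).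
Proof.
apply: (@intg_bounded _ _ _ _ _ M) => //.
by apply: measurableT_comp => //; exact: measurable_funD.
Qed.

Lemma intg_mean_shift : intg a (fun x => \int[b]_y h (x + y)).
Proof.
have := @integrable_fubini_F _ _ _ _ _ a b (EFin \o (fun p => h (p.1 + p.2))) ihD.
apply: eq_integrable => // x _ /=.
by rewrite /fubini_F /= EFin_mean//; exact: intg_bounded_shift.
Qed.

Lemma mean_convol : \int[convol a b]_z h z = \int[a]_x \int[b]_y h (x + y).
Proof.
rewrite mean_distribution// mean_prod// => x; exact: intg_bounded_shift.
Qed.

(** With the second summand integrated outermost, [convoln_swap] can apply its induction hypothesis
    under that integral. *)
Lemma mean_convol_swap :
  \int[convol a b]_z h z = \int[b]_y \int[a]_x h (x + y).
Proof.
rewrite mean_distribution// mean_prod_swap// => y/=.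
by apply: eq_integrable (intg_bounded_shift a y) => // x _ /=; rewrite addrC.
Qed.

End bounded.

Definition mom (a : law) k := \int[a]_x (x ^+ k).

Lemma mom0 a : mom a 0 = 1.
Proof. by rewrite /mom; under eq_Rintegral do rewrite expr0; exact: mean_cst. Qed.

Section moments_convol.
Context (a b : law) (n : nat).
Hypothesis ia : forall k, (k <= n)%N -> intg a (fun x => x ^+ k).
Hypothesis ib : forall k, (k <= n)%N -> intg b (fun x => x ^+ k).

Let binom_expand (p : R * R) : (p.1 + p.2) ^+ n =
  \sum_(i < n.+1) 'C(n, i)%:R * (p.1 ^+ (n - i) * p.2 ^+ i).
Proof. by rewrite exprDn; apply: eq_bigr => i _; rewrite mulr_natl. Qed.

Let intg_term (i : 'I_n.+1) : intg (a \x b)%E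
  (fun p => 'C(n, i)%:R * (p.1 ^+ (n - i) * p.2 ^+ i)).
Proof.
apply: intgZ; apply: (@intg_prod_mul a b (fun x => x ^+ (n - i)) (fun x => x ^+ i)).
  by apply: ia; exact: leq_subr.
by apply: ib; rewrite -ltnS.
Qed.

Let intg_binom : intg (a \x b)%E (fun p => (p.1 + p.2) ^+ n).
Proof. by under eq_fun do rewrite binom_expand; exact: intg_sum. Qed.

Lemma intg_convol_pow : intg (convol a b) (fun z => z ^+ n).
Proof. by apply: intg_convol; [exact: exprn_measurable|exact: intg_binom]. Qed.

Lemma mom_convol :
  mom (convol a b) n = \sum_(i < n.+1) 'C(n, i)%:R * (mom a (n - i) * mom b i).
Proof.
rewrite /mom mean_distribution; [|exact: exprn_measurable|exact: intg_binom].
under eq_Rintegral do rewrite binom_expand.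
rewrite mean_sum//; apply: eq_bigr => i _.
have ia' : intg a (fun x => x ^+ (n - i)) by apply: ia; exact: leq_subr.
have ib' : intg b (fun x => x ^+ i) by apply: ib; rewrite -ltnS.
rewrite meanZ; first by rewrite (mean_prod_mul ia' ib').
exact: (intg_prod_mul ia' ib').
Qed.

End moments_convol.

Lemma intg_pow4 (a : law) k : intg a (fun x => x ^+ 4) -> (k <= 4)%N ->
  intg a (fun x => x ^+ k).
Proof. by move=> i4 k4; exact: (@intg_pow_le _ _ _ a id k 2). Qed.

Lemma mom_dirac k : mom (\d_(0 : measurableTypeR R)) k.+1 = 0.
Proof.
rewrite /mom /Rintegral integral_dirac//.
  by rewrite diracT mul1e expr0n.
by apply/measurable_EFinP; exact: exprn_measurable.
Qed.

Lemma intg_dirac (h : R -> R) : measurable_fun setT h ->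
  intg (\d_(0 : measurableTypeR R)) h.
Proof.
move=> mh; apply/integrableP; split; first exact/measurable_EFinP.
rewrite integral_dirac//; first by rewrite diracT mul1e ltry.
by apply: measurableT_comp => //; exact/measurable_EFinP.
Qed.

(** In the fourth power of a sum of [n] centered terms, only fourth powers and products of two
    squares have nonzero mean. The latter number [C(4,2) C(n,2) = 3 n (n - 1)]. *)
Lemma moments_convoln a n : intg a (fun x => x ^+ 4) -> mom a 1 = 0 ->
  [/\ intg (convoln a n) (fun x => x ^+ 4), mom (convoln a n) 1 = 0,
    mom (convoln a n) 2 = n%:R * mom a 2 &
    mom (convoln a n) 4 = n%:R * mom a 4 + 3 * n%:R * (n%:R - 1) * mom a 2 ^+ 2].
Proof.
move=> i4 m1; elim: n => [|n [IHi IH1 IH2 IH4]].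
  rewrite /convoln !mom_dirac; split; rewrite ?mul0r ?mulr0 ?mul0r ?addr0//.
  by apply: intg_dirac; exact: exprn_measurable.
have ik k : (k <= 4)%N -> intg a (fun x => x ^+ k) by exact: intg_pow4.
have jk k : (k <= 4)%N -> intg (convoln a n) (fun x => x ^+ k).
  exact: intg_pow4.
have mk k : (k <= 4)%N -> mom (convoln a n.+1) k = \sum_(i < k.+1)
    'C(k, i)%:R * (mom (convoln a n) (k - i) * mom a i).
  by move=> k4; apply: mom_convol => j jk'; [apply: jk|apply: ik];
    exact: leq_trans k4.
split; first by apply: intg_convol_pow.
- by rewrite mk// !big_ord_recl big_ord0 /= !mom0 IH1 m1; ring.
- rewrite mk// !big_ord_recr big_ord0 /= !mom0 ?subn0 ?subnn ?subSS ?subn0 IH1 ?m1 IH2 bin0 binn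
    -natr1; ring.
- rewrite mk// !big_ord_recr big_ord0 /= !mom0 ?subSS ?subn0 ?mom0 IH1 m1 IH2 IH4 bin0 bin1 binn.
  have -> : 'C(4, 2) = 6 by []. have -> : 'C(4, 3) = 4 by [].
  by rewrite -natr1; ring.
Qed.

End Convolution.

(** * Independence of blocks *)

Section Independence.
Context (disp : measure_display) (T : measurableType disp) (R : realType).
Context (P : probability T R) (I : choiceType) (X : I -> {RV P >-> R}).
Hypothesis indepX : mutually_independent P X.
Local Notation law := (probability (measurableTypeR R) R).

Definition cylinder (A : I -> set R) : set T := [set w | forall i, A i (X i w)].

(** The pi-system of finite-dimensional events on the coordinates in [J]. The family [A] is total
    and trivial off [F] and off [J], so that intersections are coordinatewise and two cylinders can
    be enlarged to a common finite support. *)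
Definition cylinders (J : set I) : set (set T) :=
  [set B | exists F : {fset I}, exists A : I -> set R,
    [/\ forall i, measurable (A i), forall i, i \notin F -> A i = setT,
        forall i, ~ J i -> A i = setT & B = cylinder A]].

Lemma cylinder_bigcap (F : {fset I}) (A : I -> set R) :
  (forall i, i \notin F -> A i = setT) ->
  cylinder A = \bigcap_(i in [set` F]) (X i @^-1` A i).
Proof.
move=> AF; apply/seteqP; split => [w wA i _|w wA i]; first exact: wA.
by have [/wA//|/AF->] := boolP (i \in F).
Qed.

Lemma prob_cylinder (F : {fset I}) (A : I -> set R) :
  (forall i, measurable (A i)) -> (forall i, i \notin F -> A i = setT) ->
  P (cylinder A) = (\prod_(i <- F) P (X i @^-1` A i))%E.
Proof. by move=> mA AF; rewrite (cylinder_bigcap AF) indepX. Qed.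

Lemma cylinderI A B : cylinder A `&` cylinder B = cylinder (fun i => A i `&` B i).
Proof.
apply/seteqP; split => [w [wA wB] i|w wAB]; first by split; [exact: wA|exact: wB].
by split => i; case: (wAB i).
Qed.

Lemma cylinders_setI J : setI_closed (cylinders J).
Proof.
move=> _ _ [F [A [mA AF AJ ->]]] [G [B [mB BG BJ ->]]].
exists (F `|` G)%fset, (fun i => A i `&` B i); rewrite cylinderI; split => //.
- by move=> i; exact: measurableI.
- by move=> i; rewrite !inE negb_or => /andP[iF iG]; rewrite AF// BG// setTI.
- by move=> i iJ; rewrite AJ// BJ// setTI.
Qed.

Lemma measurable_cylinders J : cylinders J `<=` measurable.
Proof.
move=> _ [F [A [mA AF _ ->]]]; rewrite (cylinder_bigcap AF).
apply: fin_bigcap_measurable => // i _.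
by rewrite -[X in measurable X]setTI; exact: measurable_funP.
Qed.

(** Over the union of the two supports, each index has a trivial condition in [A] or in [B], so
    every factor of the product splits. *)
Lemma cylinders_indep J K A B : J `&` K = set0 -> cylinders J A -> cylinders K B ->
  P (A `&` B) = (P A * P B)%E.
Proof.
move=> JK [F [{}A [mA AF AJ ->]]] [G [{}B [mB BG BK ->]]].
have AFG i : i \notin (F `|` G)%fset -> A i = setT.
  by rewrite inE negb_or => /andP[/AF].
have BFG i : i \notin (F `|` G)%fset -> B i = setT.
  by rewrite inE negb_or => /andP[_ /BG].
rewrite cylinderI (prob_cylinder mA AFG) (prob_cylinder mB BFG).
rewrite (@prob_cylinder (F `|` G)%fset); last 2 first.
- by move=> i; exact: measurableI.
- by move=> i iFG; rewrite AFG// BFG// setTI.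
rewrite -big_split/=; apply: eq_bigr => i _.
have [iJ|iJ] := pselect (J i); last first.
  by rewrite AJ// setTI preimage_setT probability_setT mul1e.
rewrite (BK i) => [|iK]; last by have : (J `&` K) i by []; rewrite JK.
by rewrite setIT preimage_setT probability_setT mule1.
Qed.

(** Dynkin's argument: for fixed [B], the events [A] obeying the product rule form a lambda-system,
    and [G] is a pi-system inside it. *)
Lemma sigma_indep_l (G : set (set T)) B : setI_closed G -> G `<=` measurable ->
  measurable B -> (forall A, G A -> P (A `&` B) = (P A * P B)%E) ->
  forall A, <<s G >> A -> P (A `&` B) = (P A * P B)%E.
Proof.
move=> GI Gm mB GB.
pose H := [set A | measurable A /\ P (A `&` B) = (P A * P B)%E].
suff : <<s G >> `<=` H by move=> GH A /GH [].
apply: lambda_system_subset => //; last by move=> A GA; split; [exact: Gm|exact: GB].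
apply/dynkin_lambda_system; split.
- by split => //; rewrite setTI probability_setT mul1e.
- move=> A [mA AB]; split; first exact: measurableC.
  have -> : ~` A `&` B = B `\` A by rewrite setDE setIC.
  have -> : P (B `\` A) = (P B - P (A `&` B))%E.
    by rewrite setIC; apply: measureD => //; rewrite ltey_eq fin_num_measure.
  rewrite AB probability_setC// -(fineK (fin_num_measure P _ mA)).
  rewrite -(fineK (fin_num_measure P _ mB)) -!EFinM -!EFinB.
  by congr EFin; ring.
- move=> F tF FH; split; first by apply: bigcupT_measurable => n; case: (FH n).
  rewrite setI_bigcupl.
  have mF n : measurable (F n) by case: (FH n).
  have -> : P (\bigcup_n (F n `&` B)) = (\sum_(n <oo) P (F n `&` B))%E.
    apply: measure_semi_bigcup; [|exact: trivIset_setIr|] => *.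
      exact: measurableI.
    by apply: bigcupT_measurable => n; exact: measurableI.
  have -> : P (\bigcup_n F n) = (\sum_(n <oo) P (F n))%E.
    by apply: measure_semi_bigcup => //; exact: bigcupT_measurable.
  under eq_eseriesr do rewrite (FH _).2.
  rewrite -(fineK (fin_num_measure P _ mB)).
  by under eq_eseriesr do rewrite muleC; rewrite nneseriesZl// muleC.
Qed.

Lemma sigma_cylinders_measurable J : <<s cylinders J >> `<=` measurable.
Proof.
apply: smallest_sub; first exact: sigma_algebra_measurable.
exact: measurable_cylinders.
Qed.

(** [sigma_indep_l] is applied once on each side: cylinders are replaced by general events first in
    [K], then in [J]. *)
Lemma sigma_cylinders_indep J K A B : J `&` K = set0 ->
  <<s cylinders J >> A -> <<s cylinders K >> B -> P (A `&` B) = (P A * P B)%E.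
Proof.
move=> JK sA sB; rewrite setIC muleC.
apply: (sigma_indep_l (@cylinders_setI K)) sB => //.
- exact: measurable_cylinders.
- exact: sigma_cylinders_measurable sA.
- move=> {}B cB; rewrite setIC muleC.
  apply: (sigma_indep_l (@cylinders_setI J)) sA => //.
  + exact: measurable_cylinders.
  + exact: measurable_cylinders cB.
  + by move=> {}A cA; exact: cylinders_indep JK cA cB.
Qed.

(** Measurability for the sigma-algebra generated by the [X i] with [i] in [J]. Independence of two
    functions then reduces to disjointness of their blocks. *)
Definition block_measurable (J : set I) (U : T -> R) :=
  measurable_fun [set: g_sigma_algebraType (cylinders J)] U.

Lemma block_measurable_sub J K U : J `<=` K -> block_measurable J U ->
  block_measurable K U.
Proof.
move=> JK mU _ A mA; have := mU measurableT A mA.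
apply: sub_sigma_algebra2 => _ [F [B [mB BF BJ ->]]].
by exists F, B; split => // i iK; apply: BJ => /JK.
Qed.

Lemma block_measurable1 i : block_measurable [set i] (X i).
Proof.
move=> _ A mA; rewrite setTI; apply: sub_sigma_algebra.
exists [fset i]%fset, (fun j => if j == i then A else setT); split.
- by move=> j; case: ifP.
- by move=> j; rewrite !inE => /negbTE->.
- by move=> j /eqP/negbTE->.
- apply/seteqP; split => [w wA j|w /(_ i)]; last by rewrite eqxx.
  by case: eqP => // ->.
Qed.

(** [U] is a bare function and its measurability a conjunct, so that sums and compositions need not
    be packed as random variables. *)
Definition has_law (U : T -> R) (a : law) :=
  measurable_fun setT U /\ forall A, measurable A -> P (U @^-1` A) = a A.

(** Disjoint blocks make the joint law of [(U, V)] agree with the product of [a] and [b] on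
    rectangles, hence everywhere by uniqueness of the product measure. The sum is the image of the
    pair under [add_pair]. *)
Lemma has_law_add J K U V a b : J `&` K = set0 ->
  block_measurable J U -> block_measurable K V -> has_law U a -> has_law V b ->
  has_law (fun w => U w + V w) (convol a b).
Proof.
move=> JK JU KV [mU aU] [mV bV]; split; first exact: measurable_funD.
move=> A mA.
have mUV : measurable_fun setT (fun w => (U w, V w) : measurableTypeR R * measurableTypeR R).
  exact: measurable_fun_pair.
pose UV : {mfun T >-> (measurableTypeR R * measurableTypeR R)%type} :=
  HB.pack (fun w => (U w, V w) : measurableTypeR R * measurableTypeR R)
    (isMeasurableFun.Build _ _ _ _ _ mUV).
transitivity (distribution P UV (add_pair @^-1` A)) => //.
apply/esym; apply: (@product_measure_unique _ _ _ _ _ a b (distribution P UV)); last first.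
  by rewrite -[X in measurable X]setTI; exact: measurable_add_pair.
move=> B C mB mC; transitivity (P (U @^-1` B) * P (V @^-1` C))%E; last first.
  by congr (_ * _)%E; [exact: aU|exact: bV].
apply: (sigma_cylinders_indep JK).
  by have := JU measurableT B mB; rewrite setTI.
by have := KV measurableT C mC; rewrite setTI.
Qed.

Lemma has_law_cst0 : has_law (cst 0) (\d_(0 : measurableTypeR R)).
Proof.
split => // A mA; change (P (cst 0 @^-1` A) = dirac (0 : measurableTypeR R) A).
rewrite diracE; have [A0|A0] := boolP (_ \in A).
  rewrite (_ : _ @^-1` _ = setT) ?probability_setT//.
  by apply/seteqP; split=> // ? _; exact: set_mem.
rewrite (_ : _ @^-1` _ = set0) ?measure0//; apply/seteqP; split=> // w /= Aw.
by move: A0; rewrite mem_set.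
Qed.

(** The block of the sum is part of the conclusion both for the induction and because the lemma is
    later applied to its own output: first inside a column, then across the columns. *)
Lemma has_law_sum (J : nat -> set I) (U : nat -> T -> R) a n :
  trivIset setT J -> (forall i, block_measurable (J i) (U i)) ->
  (forall i, has_law (U i) a) ->
  block_measurable (\bigcup_(i in `I_n) J i) (fun w => \sum_(i < n) U i w) /\
  has_law (fun w => \sum_(i < n) U i w) (convoln a n).
Proof.
move=> tJ mU aU; elim: n => [|n [IHm IHl]].
  rewrite (_ : (fun w => \sum_(i < 0) U i w) = cst 0).
    by split; [exact: measurable_cst|exact: has_law_cst0].
  by apply/funext => w; rewrite big_ord0.
rewrite (_ : (fun w => \sum_(i < n.+1) U i w) =
    fun w => \sum_(i < n) U i w + U n w); last first.
  by apply/funext => w; rewrite big_ord_recr.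
split.
  apply: measurable_funD.
    by apply: block_measurable_sub IHm => x [i /= ni Jx]; exists i => //=; exact: ltnW.
  by apply: block_measurable_sub (mU n) => x Jx; exists n => /=.
apply: (@has_law_add _ (J n)) IHm (mU n) IHl (aU n).
rewrite -subset0 => x [[i /= ni Jix] Jnx].
by move: ni; rewrite (tJ i n)// ?ltnn//; exists x.
Qed.

End Independence.

(** * Gaussian laws *)

Section NormalDensity.
Context {R : realType}.
Local Notation leb := (@lebesgue_measure R).
Local Notation law := (probability (measurableTypeR R) R).

(** The Radon-Nikodym derivative of [normal_prob] and the explicit density have the same integral
    over every measurable set, so they agree almost everywhere and the change of measure can be
    written with either. *)
Lemma ge0_integral_normal_prob (m s : R) (f : R -> \bar R) :
  measurable_fun setT f -> (forall x, 0 <= f x)%E ->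
  (\int[normal_prob m s]_x f x = \int[leb]_x (f x * (normal_pdf m s x)%:E))%E.
Proof.
move=> mf f0.
pose g := Radon_Nikodym_SigmaFinite.f (normal_prob m s) leb.
have dom := normal_prob_dominates m s.
have ig : leb.-integrable setT g by exact: Radon_Nikodym_SigmaFinite.f_integrable.
rewrite -(Radon_Nikodym_SigmaFinite.change_of_variables dom)//.
apply: ge0_ae_eq_integral => //.
- by apply: emeasurable_funM => //; exact: measurable_int ig.
- apply: emeasurable_funM => //; apply/measurable_EFinP.
  exact: measurable_normal_pdf.
- move=> x _; apply: mule_ge0 => //; exact: Radon_Nikodym_SigmaFinite.f_ge0.
- by move=> x _; apply: mule_ge0 => //; rewrite lee_fin normal_pdf_ge0.
- apply: ae_eqe_mul2l; apply: integral_ae_eq => //.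
  + by apply/measurable_EFinP; exact: measurable_normal_pdf.
  + by move=> E _ mE; rewrite -Radon_Nikodym_SigmaFinite.f_integral.
Qed.

Lemma integrable_mul_normal_pdf (m s : R) (f : R -> R) :
  intg (normal_prob m s) f -> intg leb (fun x => f x * normal_pdf m s x).
Proof.
move=> intf; have mf := intg_measurable intf.
apply/integrableP; split.
  apply/measurable_EFinP; apply: measurable_funM => //.
  exact: measurable_normal_pdf.
move/integrableP: intf => [_]; apply: le_lt_trans.
rewrite ge0_integral_normal_prob//; last first.
  by apply/measurable_EFinP; exact: measurableT_comp.
rewrite le_eqVlt; apply/orP; left; apply/eqP; apply: eq_integral => x _ /=.
by rewrite -EFinM normrM (ger0_norm (normal_pdf_ge0 m s x)).
Qed.

Lemma intg_normal_prob (m s : R) (f : R -> R) : measurable_fun setT f ->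
  intg leb (fun x => f x * normal_pdf m s x) -> intg (normal_prob m s) f.
Proof.
move=> mf /integrableP[_ intf]; apply/integrableP; split; first exact/measurable_EFinP.
apply: le_lt_trans intf.
rewrite ge0_integral_normal_prob//; last first.
  by apply: measurableT_comp => //; exact/measurable_EFinP.
rewrite le_eqVlt; apply/orP; left; apply/eqP; apply: eq_integral => x _ /=.
by rewrite -EFinM normrM (ger0_norm (normal_pdf_ge0 m s x)).
Qed.

Lemma mean_normal_prob (m s : R) (f : R -> R) : intg (normal_prob m s) f ->
  \int[normal_prob m s]_x f x = \int[leb]_x (f x * normal_pdf m s x).
Proof.
move=> intf; have mf : measurable_fun setT (EFin \o f).
  by apply/measurable_EFinP; exact: intg_measurable intf.
congr fine; rewrite integralE [RHS]integralE.
rewrite !ge0_integral_normal_prob//;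
  try exact: measurable_funeneg; try exact: measurable_funepos.
(* A nonnegative density can be moved through positive and negative parts. *)
have maxp (a p : R) : 0 <= p ->
    (maxe a%:E 0 * p%:E = maxe (a * p)%:E 0)%E.
  by move=> p0; rewrite -!EFin_max -EFinM maxr_pMl// mul0r.
congr (_ - _)%E; apply: eq_integral => x _; rewrite ?funeposE ?funenegE /=.
  by rewrite maxp// normal_pdf_ge0.
by rewrite maxp ?mulNr// normal_pdf_ge0.
Qed.

Lemma lebesgue_measure_shift (c : R) (A : set R) : measurable A ->
  leb (shift c @^-1` A) = leb A.
Proof.
move=> mA.
have ms : measurable_fun (setT : set (measurableTypeR R))
    (shift c : measurableTypeR R -> measurableTypeR R) by exact: measurable_funD.
pose shifted : {mfun measurableTypeR R >-> measurableTypeR R} :=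
  HB.pack (shift c : measurableTypeR R -> measurableTypeR R)
    (isMeasurableFun.Build _ _ _ _ _ ms).
apply/esym; apply: (@lebesgue_measure_unique R (pushforward leb shifted)) => //.
move=> _ [[a b] _ <-]; 
have e : shift c @^-1` `]a, b]%classic = `]a - c, b - c]%classic.
  apply/seteqP; split => x /=; rewrite !in_itv/= /shift.
    by move=> /andP[? ?]; apply/andP; split; lra.
  by move=> /andP[? ?]; apply/andP; split; lra.
transitivity (leb `]a - c, b - c]%classic); last by rewrite -e.
rewrite !lebesgue_measure_itv/= !lte_fin ltrD2r; case: ifP => // _.
by rewrite -!EFinB; congr EFin; ring.
Qed.

Lemma ge0_integral_lebesgue_shift (c : R) (f : R -> \bar R) :
  measurable_fun setT f -> (forall x, 0 <= f x)%E ->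
  (\int[leb]_x f (x + c)%R = \int[leb]_x f x)%E.
Proof.
move=> mf f0.
have ms : measurable_fun (setT : set (measurableTypeR R))
    (shift c : measurableTypeR R -> measurableTypeR R) by exact: measurable_funD.
pose shifted : {mfun measurableTypeR R >-> measurableTypeR R} :=
  HB.pack (shift c : measurableTypeR R -> measurableTypeR R)
    (isMeasurableFun.Build _ _ _ _ _ ms).
transitivity (\int[pushforward leb shifted]_x f x)%E.
  by rewrite ge0_integral_pushforward.
by apply: eq_measure_integral => A mA _; exact: lebesgue_measure_shift.
Qed.

(** Completing the square. For independent centered [x] and [y] with [z = x + y], the left side is
    the joint density of [(x, z)]; the right side is the density of [z] times the conditional
    density of [x] given [z]. *)
Lemma normal_pdf_mul (s t x z : R) : 0 < s -> 0 < t ->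
  let r := Num.sqrt (s ^+ 2 + t ^+ 2) in
  normal_pdf 0 s x * normal_pdf 0 t (z - x) =
  normal_pdf 0 r z * normal_pdf (z * s ^+ 2 / r ^+ 2) (s * t / r) x.
Proof.
move=> s0 t0 r.
have r2 : r ^+ 2 = s ^+ 2 + t ^+ 2 by rewrite sqr_sqrtr// addr_ge0 ?sqr_ge0.
have r0 : 0 < r by rewrite sqrtr_gt0 addr_gt0// exprn_gt0.
have u0 : 0 < s * t / r by rewrite divr_gt0 ?mulr_gt0.
rewrite !normal_pdfE ?gt_eqF// /normal_peak /normal_fun.
rewrite mulrACA [RHS]mulrACA -!expRD -!invfM; congr (_^-1 * expR _).
  rewrite -!sqrtrM; last 2 first.
  - by rewrite mulrn_wge0// mulr_ge0 ?sqr_ge0 ?pi_ge0.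
  - by rewrite mulrn_wge0// mulr_ge0 ?sqr_ge0 ?pi_ge0.
  congr Num.sqrt; field; exact: lt0r_neq0.
rewrite !exprMn !exprVn r2; field.
by rewrite ?lt0r_neq0// -r2 exprn_gt0.
Qed.

Lemma convol_sectionE (a b : law) A :
  convol a b A = (\int[a]_x b [set y | A (x + y)%R])%E.
Proof.
apply: eq_integral => x _ /=; congr (b _); apply/seteqP.
by split => y /=; rewrite /xsection /= ?inE.
Qed.

Lemma measurable_section (b : law) A : measurable A ->
  measurable_fun setT (fun x : measurableTypeR R => b [set y | A (x + y)]).
Proof.
move=> mA; have mB : measurable (add_pair @^-1` A).
  by rewrite -[X in measurable X]setTI; exact: measurable_add_pair.
have := measurable_fun_xsection b mB; congr (measurable_fun _ _).
apply/funext => x /=; congr (b _); apply/seteqP.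
by split => y /=; rewrite /xsection /= ?inE.
Qed.

(** After the substitution [z = x + y] and an exchange of integrals, [normal_pdf_mul] isolates the
    conditional density of [x], which integrates to 1. *)
Lemma convol_normal_prob (s t : R) A : 0 < s -> 0 < t -> measurable A ->
  convol (normal_prob 0 s) (normal_prob 0 t) A =
  normal_prob 0 (Num.sqrt (s ^+ 2 + t ^+ 2)) A.
Proof.
move=> s0 t0 mA; set r := Num.sqrt _.
pose K (p : measurableTypeR R * measurableTypeR R) : \bar R :=
  ((\1_A p.2 * normal_pdf 0 t (p.2 - p.1)) * normal_pdf 0 s p.1)%:E.
have mK : measurable_fun setT K.
  apply/measurable_EFinP; apply: measurable_funM; last first.
    by apply: measurableT_comp => //; exact: measurable_normal_pdf.
  apply: measurable_funM.
    by apply: measurableT_comp => //; exact: measurable_indic.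
  apply: measurableT_comp; first exact: measurable_normal_pdf.
  exact: measurable_funB.
have K0 p : (0 <= K p)%E.
  by rewrite lee_fin !mulr_ge0 ?normal_pdf_ge0.
have mk x : measurable_fun setT
    (fun z : measurableTypeR R => (\1_A z * normal_pdf 0 t (z - x))%:E).
  apply/measurable_EFinP; apply: measurable_funM; first exact: measurable_indic.
  apply: measurableT_comp; first exact: measurable_normal_pdf.
  exact: measurable_funB.
have section x : normal_prob 0 t [set y | A (x + y)] =
    (\int[leb]_z (\1_A z * normal_pdf 0 t (z - x))%:E)%E.
  rewrite -(ge0_integral_lebesgue_shift x (mk x))/=; last first.
    by move=> z; rewrite lee_fin mulr_ge0 ?normal_pdf_ge0.
  transitivity (\int[leb]_(y in [set y | A (x + y)%R]) (normal_pdf 0 t y)%:E)%E => //.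
  rewrite integral_mkcond; apply: eq_integral => y _.
  have e : (y + x \in A) = (y \in [set y | A (x + y)]).
    by apply/idP/idP => /set_mem /= H; apply/mem_set; rewrite /= addrC.
  by rewrite addrK patchE indicE e; case: ifP => _; rewrite ?mul1r ?mul0r.
rewrite convol_sectionE ge0_integral_normal_prob//; last first.
  exact: measurable_section.
transitivity (\int[leb]_x \int[leb]_z K (x, z))%E.
  apply: eq_integral => x _.
  transitivity ((\int[leb]_z (\1_A z * normal_pdf 0 t (z - x))%:E) *
      (normal_pdf 0 s x)%:E)%E; first by congr (_ * _)%E; exact: section.
  rewrite -ge0_integralZr//.
  - by move=> z _; rewrite lee_fin mulr_ge0 ?normal_pdf_ge0.
  - by rewrite lee_fin normal_pdf_ge0.
rewrite (@fubini_tonelli _ _ _ _ _ leb leb)//.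
transitivity (\int[leb]_(z in A) (normal_pdf 0 r z)%:E)%E => //.
rewrite [RHS]integral_mkcond; apply: eq_integral => z _.
transitivity (\int[leb]_x ((\1_A z * normal_pdf 0 r z)%:E *
    (normal_pdf (z * s ^+ 2 / r ^+ 2) (s * t / r) x)%:E))%E.
  apply: eq_integral => x _; rewrite /K /= -EFinM; congr EFin.
  by rewrite -[LHS]mulrA -[RHS]mulrA -normal_pdf_mul// (mulrC (normal_pdf 0 t _)).
rewrite ge0_integralZl//; last 3 first.
- by apply/measurable_EFinP; exact: measurable_normal_pdf.
- by move=> x _; rewrite lee_fin normal_pdf_ge0.
- by rewrite lee_fin mulr_ge0 ?normal_pdf_ge0.
rewrite integral_normal_pdf mule1 patchE indicE.
by case: ifP => _; rewrite ?mul1r ?mul0r.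
Qed.

(** The exponent starts at 1 because the zeroth power is a Dirac mass. *)
Lemma convoln_normal_prob (s : R) n A : 0 < s -> measurable A ->
  convoln (normal_prob 0 s) n.+1 A = normal_prob 0 (Num.sqrt n.+1%:R * s) A.
Proof.
move=> s0; elim: n A => [|n IH] A mA.
  rewrite sqrtr1 mul1r; transitivity (\int[dirac (0%R : measurableTypeR R)]_x
    normal_prob 0 s [set y | A (x + y)%R])%E; first exact: convol_sectionE.
  rewrite integral_dirac//.
    rewrite diracT mul1e; congr (normal_prob _ _ _).
    by apply/seteqP; split=> y /=; rewrite add0r.
  exact: measurable_section.
have r0 : 0 < Num.sqrt n.+1%:R * s by rewrite mulr_gt0 ?sqrtr_gt0.
have -> : Num.sqrt n.+2%:R * s = Num.sqrt ((Num.sqrt n.+1%:R * s) ^+ 2 + s ^+ 2).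
  rewrite exprMn sqr_sqrtr// -[in RHS](mul1r (s ^+ 2)) mulrA mulr1 -mulrDl natr1.
  by rewrite sqrtrM// sqrtr_sqr gtr0_norm.
rewrite -convol_normal_prob//.
transitivity (\int[convoln (normal_prob 0 s) n.+1]_x
  normal_prob 0 s [set y | A (x + y)%R])%E; first exact: convol_sectionE.
rewrite convol_sectionE.
by apply: eq_measure_integral => B mB _; exact: IH.
Qed.

End NormalDensity.

(** * Moments of centered Gaussian laws by integration by parts *)

Section NormalMoments.
Context {R : realType}.
Local Notation leb := (@lebesgue_measure R).

(** The fundamental theorem of calculus on [[-n, n]], followed by dominated convergence with [|f|]
    as the bound. *)
Lemma integral_derivative_eq0 (F f : R -> R) :
  (forall x : R, is_derive x 1 F (f x)) -> continuous f -> intg leb f ->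
  (fun n : nat => F n%:R) @ \oo --> 0 ->
  (fun n : nat => F (- n%:R)) @ \oo --> 0 -> \int[leb]_x f x = 0.
Proof.
move=> dF cf intf Fp Fn.
pose f_ n := (EFin \o f) \_ `[- n%:R, n%:R]%classic.
have mf : measurable_fun setT (EFin \o f) by exact: measurable_int intf.
(* The index [n.+1] makes the interval nondegenerate, as [continuous_FTC2] requires. *)
have fint n : (\int[leb]_x f_ n.+1 x)%E = (F n.+1%:R - F (- n.+1%:R))%:E.
  rewrite /f_ -integral_mkcond (@continuous_FTC2 _ f F)//.
  - by rewrite -subr_gt0 opprK -natrD ltr0n.
  - exact: continuous_subspaceT.
  - have cF : continuous F.
      move=> x; apply/differentiable_continuous/derivable1_diffP.
      by have [] := dF x.
    split; [by move=> x _; have [] := dF x| |].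
    + exact: cvg_at_right_filter (cF _).
    + exact: cvg_at_left_filter (cF _).
  - by move=> x _; rewrite derive1E; have [_ ->] := dF x.
have cvgf : (\int[leb]_x f_ n.+1 x)%E @[n --> \oo] --> (\int[leb]_x (f x)%:E)%E.
  apply: (@dominated_cvg _ _ _ leb setT measurableT _ _ (fun x => `|f x|%:E)).
  - move=> n; apply/(measurable_restrictT _ _).1 => //.
    exact: measurable_funTS.
  - move=> x _; apply: cvg_near_cst.
    near=> n; rewrite /f_ patchE mem_set//= in_itv/= -ler_norml.
    apply: le_trans (ltW (archi_boundP (normr_ge0 x))) _.
    rewrite ler_nat ltnW// ltnS; near: n; exact: nbhs_infty_ge.
  - by [].
  - exact: integrable_norm.
  - by move=> n x _; rewrite /f_ patchE; case: ifP => //= _; rewrite normr0 lee_fin.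
have : (\int[leb]_x f_ n.+1 x)%E @[n --> \oo] --> (0 - 0)%:E.
  under eq_fun do rewrite fint.
  apply: cvg_EFin; first exact: nearW.
  apply: cvgB; first by rewrite (cvg_shiftS (fun n => F n%:R)).
  by rewrite (cvg_shiftS (fun n => F (- n%:R))).
move=> /(cvg_unique _ cvgf) e; rewrite /Rintegral e ?subrr//.
Unshelve. all: by end_near. Qed.

Lemma normal_pdf0E (s x : R) : s != 0 ->
  normal_pdf 0 s x = normal_peak s * expR (- x ^+ 2 / (s ^+ 2 *+ 2)).
Proof. by move=> s0; rewrite normal_pdfE// /normal_fun subr0. Qed.

(** Integrated over the line, this yields the recursion [mom_normalS]. At [m = 0] the truncated
    [m.-1] comes with the factor 0. *)
Lemma is_derive_pow_normal_pdf (s : R) m (x : R) : s != 0 ->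
  is_derive x 1 (fun x => x ^+ m * normal_pdf 0 s x)
    ((m%:R * x ^+ m.-1 - x ^+ m.+1 / s ^+ 2) * normal_pdf 0 s x).
Proof.
move=> s0; pose c := - (s ^+ 2 *+ 2)^-1.
pose G : R -> R := ((id : R -> R) ^+ m) *
  (normal_peak s \*: (expR \o (c \*: ((id : R -> R) ^+ 2)))).
have -> : (fun x => x ^+ m * normal_pdf 0 s x) = G.
  apply/funext => y; rewrite normal_pdf0E// /G !fctE /=.
  by rewrite /GRing.scale /=; congr (_ * (_ * expR _)); rewrite /c !mulNr mulrC.
apply: is_derive_eq; rewrite normal_pdf0E// /G !fctE /= /GRing.scale /=.
have -> : - x ^+ 2 / (s ^+ 2 *+ 2) = c * x ^+ 2 by rewrite /c !mulNr mulrC.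
rewrite (exprSr x m); set e := expR _; move: (x ^+ m) (x ^+ m.-1) e => a b e.
by rewrite /c; field.
Qed.

(** Doubling the deviation frees a factor [expR u] with [u = 3 x^2 / (8 s^2)], the difference of the
    two exponents. The constant comes from [u^4 / 4! <= expR u], solved for [x^8]. *)
Lemma pow8_normal_pdf_le (s : R) : 0 < s -> exists C : R, 0 <= C /\
  forall x, x ^+ 8 * normal_pdf 0 s x <= C * normal_pdf 0 (2 * s) x.
Proof.
move=> s0; pose c := (8 * s ^+ 2 / 3) ^+ 4 * (4`!%:R).
have c0 : 0 <= c.
  by rewrite mulr_ge0// exprn_ge0// divr_ge0// mulr_ge0// sqr_ge0.
exists (c * (normal_peak s / normal_peak (2 * s))).
have p0 : 0 < normal_peak s by rewrite normal_peak_gt0 ?gt_eqF.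
have q0 : 0 < normal_peak (2 * s) by rewrite normal_peak_gt0 ?gt_eqF ?mulr_gt0.
split; first by rewrite mulr_ge0// divr_ge0// ltW.
move=> x; rewrite !normal_pdf0E ?gt_eqF ?mulr_gt0//.
pose u := 3 * x ^+ 2 / (8 * s ^+ 2).
have u0 : 0 <= u by rewrite divr_ge0// mulr_ge0// sqr_ge0.
have hu := expR_ge1Dxn 3 u0.
have x8 : x ^+ 8 <= c * expR u.
  have -> : x ^+ 8 = (8 * s ^+ 2 / 3) ^+ 4 * u ^+ 4.
    by rewrite /u; field; exact: lt0r_neq0.
  rewrite /c -(mulrA _ _ (expR u)) ler_pM2l ?exprn_gt0 ?divr_gt0 ?mulr_gt0 ?exprn_gt0//.
  rewrite mulrC -ler_pdivrMr ?ltr0n ?fact_gt0//.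
  by apply: le_trans hu; rewrite lerDr.
have -> : expR (- x ^+ 2 / ((2 * s) ^+ 2 *+ 2)) =
    expR u * expR (- x ^+ 2 / (s ^+ 2 *+ 2)).
  by rewrite -expRD /u; congr expR; field; exact: lt0r_neq0.
set e := expR (- _ / _).
have -> : c * (normal_peak s / normal_peak (2 * s)) *
    (normal_peak (2 * s) * (expR u * e)) = (c * expR u) * (normal_peak s * e).
  by field; exact: lt0r_neq0.
by rewrite ler_wpM2r// mulr_ge0 ?expR_ge0// ltW.
Qed.

Lemma intg_normal_pow8 (s : R) : 0 < s -> intg (normal_prob 0 s) (fun x => x ^+ 8).
Proof.
move=> s0; apply: intg_normal_prob; first exact: exprn_measurable.
have [C [C0 hC]] := pow8_normal_pdf_le s0.
have := integrableZl measurableT C (integrable_normal_pdf 0 (2 * s)).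
apply: le_integrable => //.
  apply/measurable_EFinP; apply: measurable_funM; first exact: exprn_measurable.
  exact: measurable_normal_pdf.
move=> x _; rewrite /= lee_fin ger0_norm; last first.
  by rewrite mulr_ge0 ?normal_pdf_ge0// (exprM x 2 4) exprn_ge0 ?sqr_ge0.
by rewrite ger0_norm ?hC// mulr_ge0 ?normal_pdf_ge0.
Qed.

Lemma intg_normal_pow (s : R) k : 0 < s -> (k <= 8)%N ->
  intg (normal_prob 0 s) (fun x => x ^+ k).
Proof.
move=> s0 k8; exact: (@intg_pow_le _ _ _ (normal_prob 0 s) id k 4 _ k8 (intg_normal_pow8 s0)).
Qed.

(** As [m < 8], the bound on [x^8] leaves a power to spare, hence a decay in [1/n]. The sign [e]
    covers both ends of the line. *)
Lemma pow_normal_pdf_cvg0 (s : R) m (e : R) : 0 < s -> (m < 8)%N -> `|e| = 1 ->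
  (fun n : nat => (e * n%:R) ^+ m * normal_pdf 0 s (e * n%:R)) @ \oo --> 0.
Proof.
move=> s0 m8 e1; have [C [C0 hC]] := pow8_normal_pdf_le s0.
pose D := C * normal_peak (2 * s).
rewrite -(cvg_shiftS (fun n => (e * n%:R) ^+ m * normal_pdf 0 s (e * n%:R))).
apply: (@squeeze_cvgr _ _ _ _ (fun n => - (D * n.+1%:R^-1)) (fun n => D * n.+1%:R^-1)).
- apply: nearW => n; rewrite -ler_norml.
  have n0 : 0 < n.+1%:R :> R by [].
  rewrite ler_pdivlMr// -[X in _ * X](@ger0_norm _ n.+1%:R)//.
  have -> : `|n.+1%:R| = `|e * n.+1%:R| by rewrite normrM e1 mul1r.
  have x1 : 1 <= `|e * n.+1%:R| by rewrite normrM e1 mul1r ger0_norm// ler1n.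
  set x := e * _ in x1 *.
  rewrite normrM (ger0_norm (normal_pdf_ge0 0 s x)) normrX mulrAC -exprSr.
  apply: (@le_trans _ _ (x ^+ 8 * normal_pdf 0 s x)).
    rewrite ler_wpM2r ?normal_pdf_ge0//.
    rewrite -[leRHS]ger0_norm; last by rewrite (exprM x 2 4) exprn_ge0 ?sqr_ge0.
    by rewrite normrX ler_weXn2l.
  apply: le_trans (hC x) _; rewrite ler_wpM2l//.
  by rewrite normal_pdf_ub// gt_eqF// mulr_gt0.
- rewrite -oppr0 -(mulr0 D); apply: cvgN; apply: cvgMr; exact: cvg_harmonic.
- rewrite -(mulr0 D); apply: cvgMr; exact: cvg_harmonic.
Qed.

(** Gaussian integration by parts: the derivative of [x^m] times the density has integral zero. *)
Lemma mom_normalS (s : R) m : 0 < s -> (m < 8)%N ->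
  mom (normal_prob 0 s) m.+1 = s ^+ 2 * (m%:R * mom (normal_prob 0 s) m.-1).
Proof.
move=> s0 m8; have s0' : s != 0 by rewrite gt_eqF.
have i1 : intg (normal_prob 0 s) (fun x => m%:R * x ^+ m.-1).
  apply: intgZ; apply: intg_normal_pow => //.
  by rewrite (leq_trans (leq_pred _))// ltnW.
have i2 : intg (normal_prob 0 s) (fun x => (s ^+ 2)^-1 * x ^+ m.+1).
  by apply: intgZ; exact: intg_normal_pow.
pose f x := m%:R * x ^+ m.-1 - (s ^+ 2)^-1 * x ^+ m.+1.
have if_ : intg (normal_prob 0 s) f by exact: intgB.
suff e : \int[normal_prob 0 s]_x f x = 0.
  move: e; rewrite meanB// !meanZ//; last 2 first.
  - exact: intg_normal_pow.
  - apply: intg_normal_pow => //.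
    by rewrite (leq_trans (leq_pred _))// ltnW.
  move=> /subr0_eq ->; rewrite mulrA divff ?mul1r//.
  by rewrite expf_neq0.
rewrite mean_normal_prob//.
apply: (@integral_derivative_eq0 (fun x => x ^+ m * normal_pdf 0 s x)).
- move=> x; apply: is_derive_eq (is_derive_pow_normal_pdf m x s0') _.
  by rewrite /f [_ / s ^+ 2]mulrC.
- move=> x; apply: cvgM; last exact: continuous_normal_pdf.
  apply: cvgB; (apply: cvgM; first exact: cvg_cst); exact: exprn_continuous.
- exact: integrable_mul_normal_pdf.
- have := @pow_normal_pdf_cvg0 s m 1 s0 m8 (normr1 _).
  by under eq_fun do rewrite mul1r.
- have := @pow_normal_pdf_cvg0 s m (-1) s0 m8 (normrN1 _).
  by under eq_fun do rewrite mulN1r.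
Qed.

(** The sixth moment is there to bound the Gaussian tail of [x^4] in [tail_cvg], where its constant
    15 reappears. *)
Lemma mom_normal (s : R) : 0 < s ->
  [/\ mom (normal_prob 0 s) 1 = 0, mom (normal_prob 0 s) 2 = s ^+ 2,
     mom (normal_prob 0 s) 4 = 3 * s ^+ 4 & mom (normal_prob 0 s) 6 = 15 * s ^+ 6].
Proof.
move=> s0; have m1 := @mom_normalS s 0 s0 isT; have m2 := @mom_normalS s 1 s0 isT.
have m4 := @mom_normalS s 3 s0 isT; have m6 := @mom_normalS s 5 s0 isT.
rewrite m6 /= m4 /= m2 /= m1 /= mom0; split => //; ring.
Qed.

End NormalMoments.

(** * Smooth test functions *)

Section Smoothing.
Context {R : realType}.
Local Notation leb := (@lebesgue_measure R).
Implicit Types (f g : R -> R).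

Lemma is_derive_continuous f (df : R -> R) :
  (forall x : R, is_derive x 1 f (df x)) -> continuous f.
Proof.
move=> dF x; apply/differentiable_continuous/derivable1_diffP.
by have [] := dF x.
Qed.

Lemma mean_value f (df : R -> R) (x y : R) :
  (forall x : R, is_derive x 1 f (df x)) ->
  exists2 c, `|c - x| <= `|y - x| & f y - f x = df c * (y - x).
Proof.
move=> dF; have cf := is_derive_continuous dF.
have [xy|/ltW yx] := leP x y.
  have [c] := @MVT_segment R f df x y xy (fun x _ => dF x) (continuous_subspaceT cf).
  rewrite in_itv/= => /andP[xc cy] e; exists c => //.
  by rewrite !ger0_norm ?subr_ge0// lerD2r.
have [c] := @MVT_segment R f df y x yx (fun x _ => dF x) (continuous_subspaceT cf).
rewrite in_itv/= => /andP[yc cx] e; exists c.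
  by rewrite !ler0_norm ?subr_le0// lerN2 lerD2r.
by rewrite -opprB e; ring.
Qed.

Lemma compact_support_unif_continuous f (L eps : R) : continuous f ->
  (forall x, L < `|x| -> f x = 0) -> 0 < eps ->
  exists2 d, 0 < d & forall x y, `|y - x| < d -> `|f y - f x| <= eps.
Proof.
move=> cf f0 e0.
pose P (d x : R) := forall y, `|y - x| < d -> `|f y - f x| <= eps.
(* The covering form of compactness merges the local moduli of continuity, taken along small
   positive [d], into one modulus for the segment. *)
have /compact_near_coveringP/(_ _ (0^'+) P _) : compact `[- L - 1, L + 1]%classic.
  exact: segment_compact.
case.
  move=> x _; have e2 : 0 < eps / 2 by rewrite divr_gt0.
  have /cvgrPdist_lt/(_ _ e2)/nbhs_ballP[d /= d0 hd] := cf x.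
  have d2 : 0 < d / 2 by rewrite divr_gt0.
  exists (ball x (d / 2), [set r | r < d / 2]) => /=.
    by split; [exact: nbhsx_ballx|exact: nbhs_right_lt].
  move=> [x' r] /= [xx' rd] y yx'.
  have h1 : `|f x - f x'| < eps / 2.
    by apply: hd; apply: lt_trans xx' _; rewrite ltr_pdivrMr// ltr_pMr// ltr1n.
  have h2 : `|f x - f y| < eps / 2.
    apply: hd; rewrite /ball /= [X in _ < X]splitr.
    rewrite (le_lt_trans (ler_distD x' _ _))// ltrD// distrC.
    exact: lt_trans yx' rd.
  rewrite (le_trans (ler_distD (f x) _ _))// [leRHS]splitr lerD ?ltW//.
  by rewrite distrC.
(* The cap at 1 handles [x] outside the enlarged segment: a point closer than 1 is then still
   outside the support, and both values vanish. *)
move=> d /= d0 hd; pose r := Num.min 1 (d / 2).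
have r0 : 0 < r by rewrite lt_min ltr01 divr_gt0.
have rd : `|0 - r| < d.
  rewrite sub0r normrN gtr0_norm// gt_min; apply/orP; right.
  by rewrite ltr_pdivrMr// ltr_pMr// ltr1n.
exists r => // x y yx.
have [xL|xL] := boolP (x \in `[- L - 1, L + 1]); first exact: (hd r rd r0).
have r1 : r <= 1 by rewrite ge_min lexx.
have x1 : L + 1 < `|x|.
  rewrite ltNge; apply: contra xL; rewrite ler_norml in_itv/= => /andP[? ?].
  by apply/andP; split; lra.
have y1 : L < `|y|.
  rewrite ltNge; apply/negP => yL.
  have := ler_distD 0 x y; rewrite subr0 sub0r normrN.
  have := ler_normD (x - y) y; rewrite subrK distrC; lra.
rewrite !f0 ?subrr ?normr0 ?ltW//; lra.
Qed.

Lemma compact_support_antiderivative f (L : R) : continuous f ->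
  (forall x, L < `|x| -> f x = 0) ->
  exists F : R -> R, forall x : R, is_derive x 1 F (f x).
Proof.
move=> cf f0; have intf : leb.-integrable setT (EFin \o f).
  have -> : EFin \o f = EFin \o (f \_ `[- L, L]%classic).
    apply/funext => x /=; rewrite patchE; case: ifPn => // /negP xL; rewrite f0//.
    rewrite ltNge; apply/negP; rewrite ler_norml => h; apply: xL.
    by apply/mem_set; rewrite /= in_itv.
  rewrite -restrict_EFin; apply/integrable_restrict => //=; rewrite setTI.
  by apply: continuous_compact_integrable;
    [exact: segment_compact|exact: continuous_subspaceT].
exists (fun x => \int[leb]_(t in `]-oo, x]%classic) f t) => x.
have i1 : leb.-integrable `]-oo, (x + 1)]%classic (EFin \o f).
  exact: integrableS intf.
have xx1 : x < x + 1 by rewrite ltrDl.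
have [dF F'] := @continuous_FTC1 R f -oo%O x (x + 1) xx1 i1 (ltNyr x) (cf x).
by apply: DeriveDef => //; rewrite -derive1E.
Qed.

(** By [key], the average of [f] over [[x, x + h]] is a value of [f] at distance at most [h] from
    [x]. The bound [M], the support ([h <= 1]) and the closeness ([h < d]) all follow. The
    derivative is given as a difference quotient so that it can be differentiated again once [f] is
    smooth. *)
Lemma smoothing_step f (M L eps : R) : continuous f -> (forall x, `|f x| <= M) ->
  (forall x, L < `|x| -> f x = 0) -> 0 < eps ->
  exists g : R -> R, exists h : R, [/\ 0 < h,
    forall x, `|g x| <= M, forall x, L + 1 < `|x| -> g x = 0,
    forall x, `|g x - f x| <= eps &
    forall x : R, is_derive x 1 g ((f (x + h) - f x) / h)].
Proof.
move=> cf fM f0 e0.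
have [d d0 hd] := compact_support_unif_continuous cf f0 e0.
have [F dF] := compact_support_antiderivative cf f0.
pose h := Num.min 1 (d / 2).
have h0 : 0 < h by rewrite lt_min ltr01 divr_gt0.
have h1 : h <= 1 by rewrite ge_min lexx.
have hd2 : h < d.
  by rewrite gt_min; apply/orP; right; rewrite ltr_pdivrMr// ltr_pMr// ltr1n.
have key x : exists2 c, `|c - x| <= h & (F (x + h) - F x) / h = f c.
  have [c cx ->] := @mean_value F f x (x + h) dF; exists c.
    by move: cx; rewrite (addrC x h) addrK (gtr0_norm h0).
  by rewrite (addrC x h) addrK mulfK// gt_eqF.
exists (fun x => (F (x + h) - F x) / h), h; split => //.
- by move=> x; have [c _ ->] := key x.
- move=> x xL; have [c cx ->] := key x; apply: f0.
  have := ler_normD (x - c) c; rewrite subrK distrC; lra.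
- move=> x; have [c cx ->] := key x; apply: hd; exact: le_lt_trans cx hd2.
- move=> x; pose G : R -> R := h^-1 \*: ((F \o shift h) - F).
  have -> : (fun x => (F (x + h) - F x) / h) = G.
    by apply/funext => y; rewrite /G !fctE /= mulrC.
  have dFh : is_derive x 1 (F \o shift h) (f (x + h)).
    have := @is_derive1_comp R F (shift h) x _ _ (dF (x + h)) (is_derive_shift x 1 h).
    by rewrite mulr1.
  by apply: is_derive_eq; rewrite mulrC.
Qed.

Definition Phi (y : R) := Num.min (y ^+ 2) (`|y| ^+ 3).

(** The coefficients stay abstract: in the swap, centering removes [g1] and nearly equal second
    moments remove most of [g2], whatever these functions are. *)
Definition taylor2 (g : R -> R) (K : R) := exists g1 g2 : R -> R,
  forall x y, `|g (x + y) - g x - g1 x * y - g2 x * y ^+ 2| <= K * Phi y.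

Lemma mean_value_bound f (df : R -> R) (y C : R) :
  (forall x : R, is_derive x 1 f (df x)) -> f 0 = 0 ->
  (forall t, `|t| <= `|y| -> `|df t| <= C) -> `|f y| <= C * `|y|.
Proof.
move=> dF f0 hC; have [c] := @mean_value f df 0 y dF.
rewrite !subr0 f0 subr0 => cy ->; rewrite normrM ler_wpM2r//; exact: hC.
Qed.

(** The remainder of order zero of [k], namely [r2], is bounded both by [2 B] and by [D |t|]. Two
    uses of the mean value theorem turn the first bound into a quadratic and the second into a cubic
    one for [r]. The factors 1/2 and 1/6 of the sharp bounds are given up. *)
Lemma taylor2_bound (g g1 k dk : R -> R) (B D : R) :
  (forall x : R, is_derive x 1 g (g1 x)) ->
  (forall x : R, is_derive x 1 g1 (k x)) ->
  (forall x : R, is_derive x 1 k (dk x)) ->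
  (forall x, `|k x| <= B) -> (forall x, `|dk x| <= D) ->
  taylor2 g (Num.max (2 * B) D).
Proof.
move=> dg dg1 dk' kB dkD; exists g1, (fun x => k x / 2) => x y.
pose r2 t := k (x + t) - k x.
pose r1 t := g1 (x + t) - g1 x - k x * t.
pose r t := g (x + t) - g x - g1 x * t - k x / 2 * t ^+ 2.
have dshift (a da : R -> R) (t : R) : (forall x : R, is_derive x 1 a (da x)) ->
    is_derive t 1 (fun t => a (x + t)) (da (x + t)).
  move=> aD.
  have := @is_derive1_comp R a (shift x) t _ _ (aD (t + x)) (is_derive_shift t 1 x).
  rewrite mulr1 addrC; congr is_derive.
  by apply/funext => u /=; rewrite addrC.
have dr1 (t : R) : is_derive t 1 r1 (r2 t).
  have d1 := dshift g1 k t dg1.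
  have -> : r1 = (fun t => g1 (x + t)) - (cst (g1 x) + k x \*: id).
    by apply/funext => u; rewrite /r1 !fctE /= /GRing.scale /= opprD addrA.
  by apply: is_derive_eq; rewrite /r2 add0r /GRing.scale /= mulr1.
have dr (t : R) : is_derive t 1 r (r1 t).
  have d1 := dshift g g1 t dg.
  have -> : r = (fun t => g (x + t)) -
      (cst (g x) + (g1 x \*: id + (k x / 2) \*: ((id : R -> R) ^+ 2))).
    by apply/funext => u; rewrite /r !fctE /= /GRing.scale /=; ring.
  by apply: is_derive_eq; rewrite /r1 /GRing.scale /=; field.
have r20 t : `|r2 t| <= 2 * B.
  by rewrite (le_trans (ler_normB _ _))// mulr2n mulrDl mul1r lerD.
have r2L t : `|r2 t| <= D * `|t|.
  have [c _ e] := mean_value x (x + t) dk'.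
  by rewrite /r2 e (addrC x t) addrK normrM ler_wpM2r.
have r10 : r1 0 = 0 by rewrite /r1 addr0 mulr0 !subrr.
have r00 : r 0 = 0 by rewrite /r addr0 expr0n/= !mulr0 !subrr.
have r1B t : `|r1 t| <= 2 * B * `|t|.
  by apply: mean_value_bound dr1 r10 _ => u _; exact: r20.
have r1L t : `|r1 t| <= D * `|t| * `|t|.
  apply: mean_value_bound dr1 r10 _ => u ut; rewrite (le_trans (r2L u))//.
  by rewrite ler_wpM2l// (le_trans _ (dkD 0)).
have B0 : 0 <= 2 * B by rewrite mulr_ge0// (le_trans _ (kB 0)).
have D0 : 0 <= D by rewrite (le_trans _ (dkD 0)).
have rB : `|r y| <= 2 * B * `|y| * `|y|.
  apply: mean_value_bound dr r00 _ => u uy; rewrite (le_trans (r1B u))//.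
  by rewrite ler_wpM2l.
have rL : `|r y| <= D * `|y| * `|y| * `|y|.
  apply: mean_value_bound dr r00 _ => u uy; rewrite (le_trans (r1L u))//.
  by rewrite ler_pM ?mulr_ge0 ?ler_wpM2l.
rewrite -/(r y) /Phi minr_pMr ?le_max ?B0// le_min; apply/andP; split.
  apply: le_trans rB _; rewrite -mulrA -expr2 real_normK ?num_real//.
  by rewrite ler_wpM2r ?sqr_ge0// le_max lexx.
apply: le_trans rL _; rewrite -!mulrA -expr2 -exprS.
by rewrite ler_wpM2r ?exprn_ge0// le_max lexx orbT.
Qed.

(** The second and third derivatives of [g] are iterated difference quotients of [f1] and of [f], so
    they are bounded by sup norms alone, with a factor [2 / h] for each quotient. *)
Lemma smooth_approximation f (M L eps : R) : continuous f ->
  (forall x, `|f x| <= M) -> (forall x, L < `|x| -> f x = 0) -> 0 < eps ->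
  exists g : R -> R, exists K : R, [/\ continuous g, forall x, `|g x| <= M,
    forall x, `|g x - f x| <= eps, 0 <= K & taylor2 g K].
Proof.
move=> cf fM f0 e0; have e3 : 0 < eps / 3 by rewrite divr_gt0.
have [f1 [h1 [h10 f1M f10 f1f df1]]] := smoothing_step cf fM f0 e3.
have cf1 := is_derive_continuous df1.
have [f2 [h2 [h20 f2M f20 f2f df2]]] := smoothing_step cf1 f1M f10 e3.
have cf2 := is_derive_continuous df2.
have [g [h3 [h30 gM g0 gf dg]]] := smoothing_step cf2 f2M f20 e3.
have diff_derive (u du : R -> R) (h : R) : (forall x : R, is_derive x 1 u (du x)) ->
    forall x : R, is_derive x 1 (fun x => (u (x + h) - u x) / h) ((du (x + h) - du x) / h).
  move=> uD x; have -> : (fun x => (u (x + h) - u x) / h) = h^-1 \*: ((u \o shift h) - u).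
    by apply/funext => y; rewrite !fctE /= mulrC.
  have duh : is_derive x 1 (u \o shift h) (du (x + h)).
    have := @is_derive1_comp R u (shift h) x _ _ (uD (x + h)) (is_derive_shift x 1 h).
    by rewrite mulr1.
  by apply: is_derive_eq; rewrite mulrC.
have diff_bound (u : R -> R) (h C : R) : 0 < h -> (forall x, `|u x| <= C) ->
    forall x, `|(u (x + h) - u x) / h| <= 2 * C / h.
  move=> h0 uC x; rewrite normrM normfV (gtr0_norm h0) ler_pM2r ?invr_gt0//.
  by rewrite (le_trans (ler_normB _ _))// mulr2n mulrDl mul1r lerD.
have dg1 := diff_derive _ _ h3 df2.
have dg2 := diff_derive _ _ h3 (diff_derive _ _ h2 df1).
have bk := diff_bound _ _ _ h30 (diff_bound _ _ _ h20 f1M).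
have bdk := diff_bound _ _ _ h30 (diff_bound _ _ _ h20 (diff_bound _ _ _ h10 fM)).
have T := taylor2_bound dg dg1 dg2 bk bdk.
exists g; eexists; split; [exact: is_derive_continuous dg|exact: gM| | |exact: T].
- move=> x; rewrite (_ : g x - f x = (g x - f2 x) + (f2 x - f1 x) + (f1 x - f x)); last by ring.
  rewrite (le_trans (ler_normD _ _))// (_ : eps = eps / 3 + eps / 3 + eps / 3); last by field.
  by rewrite lerD// (le_trans (ler_normD _ _))// lerD.
- rewrite le_max; apply/orP; left; rewrite mulr_ge0//.
  exact: le_trans (bk 0).
Qed.

End Smoothing.

(** * Central limit theorem for arrays *)

Section ArrayCLT.
Context {R : realType}.
Local Notation law := (probability (measurableTypeR R) R).
Implicit Types (a b : law) (g f : R -> R).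

Lemma measurable_continuous f : continuous f -> measurable_fun setT f.
Proof. exact: continuous_measurable_fun. Qed.

Lemma measurable_Phi : measurable_fun setT (@Phi R).
Proof.
by apply: measurable_minr; apply: measurable_funX => //; exact: measurableT_comp.
Qed.

Lemma Phi_ge0 (y : R) : 0 <= Phi y.
Proof. by rewrite le_min sqr_ge0 exprn_ge0. Qed.

Lemma Phi_le_sqr (y : R) : Phi y <= y ^+ 2.
Proof. by rewrite ge_min lexx. Qed.

Lemma Phi_le_cube (y : R) : Phi y <= `|y| ^+ 3.
Proof. by rewrite ge_min lexx orbT. Qed.

Lemma intg_Phi a : intg a (fun x => x ^+ 2) -> intg a (@Phi R).
Proof.
apply: intg_le; first exact: measurable_Phi.
by move=> y; rewrite ger0_norm ?Phi_ge0 ?Phi_le_sqr.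
Qed.

Lemma intg_pow2 a k : intg a (fun x => x ^+ 2) -> (k <= 2)%N ->
  intg a (fun x => x ^+ k).
Proof. by move=> i2 k2; exact: (@intg_pow_le _ _ _ a id k 1). Qed.

Lemma moments2_convoln a n : intg a (fun x => x ^+ 2) -> mom a 1 = 0 ->
  [/\ intg (convoln a n) (fun x => x ^+ 2), mom (convoln a n) 1 = 0 &
    mom (convoln a n) 2 = n%:R * mom a 2].
Proof.
move=> i2 m1; elim: n => [|n [IHi IH1 IH2]].
  rewrite /convoln !mom_dirac mul0r; split => //.
  by apply: intg_dirac; exact: exprn_measurable.
have mk k : (k <= 2)%N -> mom (convoln a n.+1) k = \sum_(i < k.+1)
    'C(k, i)%:R * (mom (convoln a n) (k - i) * mom a i).
  move=> k2; apply: mom_convol => j jk; apply: intg_pow2 => //;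
  exact: leq_trans k2.
split.
- by apply: intg_convol_pow => j j2; exact: intg_pow2.
- by rewrite mk// !big_ord_recl big_ord0 /= !mom0 IH1 m1; ring.
- rewrite mk// !big_ord_recr big_ord0 /= !mom0 ?subn0 ?subnn ?subSS ?subn0 IH1 ?m1 IH2.
  by rewrite bin0 binn -natr1; ring.
Qed.

Section swap.
Context (a b : law) (g : R -> R) (M D : R).
Hypotheses (mg : measurable_fun setT g) (gM : forall x, `|g x| <= M).
Hypothesis gab : forall x,
  `|\int[a]_y g (x + y) - \int[b]_y g (x + y)| <= D.

Let mshift (x : R) : measurable_fun setT (fun z : R => g (x + z)).
Proof. by apply: measurableT_comp => //; exact: measurable_funD. Qed.

(** One summand is swapped at a cost [D], the others by induction. The shift [x] varies in the
    induction because the summand integrated outermost acts as a translation. *)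
Lemma convoln_swap n x :
  `|\int[convoln a n]_z g (x + z) - \int[convoln b n]_z g (x + z)| <= n%:R * D.
Proof.
elim: n x => [|n IH] x; first by rewrite subrr normr0 mul0r.
have hM z : `|g (x + z)| <= M by exact: gM.
have ishift (c c' : law) : intg c (fun z => \int[c']_y g (x + (z + y))).
  exact: (@intg_mean_shift R c c' _ M (mshift x) hM).
have D0 : 0 <= D by rewrite (le_trans _ (gab 0)).
have step1 : `|\int[convol (convoln a n) a]_z g (x + z) -
    \int[convol (convoln a n) b]_z g (x + z)| <= D.
  rewrite !(mean_convol _ _ (mshift x) hM) -meanB//.
  rewrite -[leRHS](mean_cst (convoln a n)); apply: le_norm_mean.
  - by apply: intgB.
  - exact: intg_cst.
  - by move=> z; under eq_Rintegral do rewrite addrA;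
      under [X in _ - X]eq_Rintegral do rewrite addrA; exact: gab.
have step2 : `|\int[convol (convoln a n) b]_z g (x + z) -
    \int[convol (convoln b n) b]_z g (x + z)| <= n%:R * D.
  rewrite !(mean_convol_swap _ _ (mshift x) hM).
  have e (c : law) y : \int[c]_z g (x + (z + y)) = \int[c]_z g ((x + y) + z).
    by apply: eq_Rintegral => z _; congr g; ring.
  have i (c : law) : intg b (fun y => \int[c]_z g (x + (z + y))).
    have := ishift b c; apply: eq_integrable => // y _ /=; congr EFin.
    by apply: eq_Rintegral => z _; congr g; ring.
  rewrite -meanB// -[leRHS](mean_cst b); apply: le_norm_mean.
  - exact: intgB.
  - exact: intg_cst.
  - by move=> y; rewrite !e; exact: IH.
rewrite -natr1 mulrDl mul1r [leRHS]addrC.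
rewrite (_ : _ - _ = (\int[convol (convoln a n) a]_z g (x + z) -
    \int[convol (convoln a n) b]_z g (x + z)) +
  (\int[convol (convoln a n) b]_z g (x + z) -
    \int[convol (convoln b n) b]_z g (x + z))); last by rewrite addrA subrK.
by rewrite (le_trans (ler_normD _ _))// lerD.
Qed.

End swap.

(** The second moments may differ: the rows to which this is applied have total variance 1 only in
    the limit. *)
Lemma taylor2_mean a b g (M K x : R) : measurable_fun setT g ->
  (forall x, `|g x| <= M) -> 0 <= K -> taylor2 g K ->
  intg a (fun x => x ^+ 2) -> mom a 1 = 0 ->
  intg b (fun x => x ^+ 2) -> mom b 1 = 0 ->
  `|\int[a]_y g (x + y) - \int[b]_y g (x + y)| <=
  K * (\int[a]_y Phi y + \int[b]_y Phi y) + (2 * M + K) * `|mom a 2 - mom b 2|.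
Proof.
move=> mg gM K0 [g1 [g2 gT]] a2 a1 b2 b1.
(* Adding the expansions at [y = 1] and [y = -1] removes [g1] and bounds [2 g2 x] by [4 M + 2 K]. *)
have g2M : `|g2 x| <= 2 * M + K.
  have Phi1 (e : R) : `|e| = 1 -> Phi e <= 1.
    by move=> e1; rewrite (le_trans (Phi_le_cube _))// e1 expr1n.
  have t1 : `|g (x + 1) - g x - g1 x * 1 - g2 x * 1 ^+ 2| <= K.
    by rewrite (le_trans (gT x 1))// ler_piMr// Phi1 ?normr1.
  have t2 : `|g (x + -1) - g x - g1 x * -1 - g2 x * (-1) ^+ 2| <= K.
    by rewrite (le_trans (gT x (-1)))// ler_piMr// Phi1 ?normrN1.
  have := gM (x + 1); have := gM (x + -1); have := gM x.
  move: t1 t2; rewrite !ler_norml sqrrN expr1n.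
  by move=> /andP[? ?] /andP[? ?] /andP[? ?] /andP[? ?] /andP[? ?]; apply/andP; split; lra.
have one (c : law) : intg c (fun x => x ^+ 2) -> mom c 1 = 0 ->
    `|\int[c]_y g (x + y) - (g x + g2 x * mom c 2)| <= K * \int[c]_y Phi y.
  move=> c2 c1.
  have igs : intg c (fun y => g (x + y)) by exact: (@intg_bounded_shift _ _ M).
  have i1 : intg c (fun y => g1 x * y ^+ 1) by apply: intgZ; exact: intg_pow2 c2 _.
  have i2 : intg c (fun y => g2 x * y ^+ 2) by exact: intgZ.
  have i0 : intg c (cst (g x)) by exact: intg_cst.
  have -> : g x + g2 x * mom c 2 =
      \int[c]_y (g x + g1 x * y ^+ 1 + g2 x * y ^+ 2).
    rewrite meanD//; last exact: intgD.
    rewrite meanD// mean_cst !meanZ//; last exact: intg_pow2 c2 _.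
    by rewrite -/(mom c 1) -/(mom c 2) c1 mulr0 addr0.
  have i012 : intg c (fun y => g x + g1 x * y ^+ 1 + g2 x * y ^+ 2).
    by apply: intgD => //; exact: intgD.
  rewrite -meanB// -meanZ; last exact: intg_Phi.
  apply: le_norm_mean; [exact: intgB|by apply: intgZ; exact: intg_Phi|].
  by move=> y; have := gT x y; rewrite expr1 !opprD !addrA.
rewrite (_ : _ - _ = (\int[a]_y g (x + y) - (g x + g2 x * mom a 2)) -
  (\int[b]_y g (x + y) - (g x + g2 x * mom b 2)) + g2 x * (mom a 2 - mom b 2));
  last by ring.
rewrite (le_trans (ler_normD _ _))// lerD//; last by rewrite normrM ler_wpM2r.
by rewrite mulrDr (le_trans (ler_normB _ _))// lerD// one.
Qed.

(** The absolute third moment is avoided through [|y|^3 <= s y^2 + y^4 / s], whose right side has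
    mean [s^3 + 3 s^3]. *)
Lemma normal_Phi_le (s : R) : 0 < s -> \int[normal_prob 0 s]_y Phi y <= 4 * s ^+ 3.
Proof.
move=> s0; have [_ m2 m4 _] := mom_normal s0.
have i2 : intg (normal_prob 0 s) (fun x => x ^+ 2) by exact: intg_normal_pow.
have i4 : intg (normal_prob 0 s) (fun x => x ^+ 4) by exact: intg_normal_pow.
have -> : 4 * s ^+ 3 = s * mom (normal_prob 0 s) 2 + s^-1 * mom (normal_prob 0 s) 4.
  by rewrite m2 m4; field; exact: lt0r_neq0.
rewrite -!meanZ// -meanD; [|exact: intgZ|exact: intgZ].
apply: le_mean; [exact: intg_Phi|by apply: intgD; exact: intgZ|move=> y].
rewrite (le_trans (Phi_le_cube y))//.
have -> : s * y ^+ 2 + s^-1 * y ^+ 4 =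
    `|y| ^+ 3 + s^-1 * y ^+ 2 * ((s - `|y|) ^+ 2 + s * `|y|).
  have -> : y ^+ 4 = `|y| ^+ 4 by rewrite -normrX ger0_norm// (exprM y 2 2) sqr_ge0.
  have -> : y ^+ 2 = `|y| ^+ 2 by rewrite real_normK ?num_real.
  by field; exact: lt0r_neq0.
rewrite lerDl; apply: mulr_ge0.
  by rewrite mulr_ge0 ?sqr_ge0// invr_ge0 ltW.
by rewrite addr_ge0 ?sqr_ge0// mulr_ge0// ltW.
Qed.

(** A continuous substitute for the indicator of [|x| < A]: truncated continuous functions remain
    admissible in weak convergence. *)
Definition cutoff (A x : R) := Num.max 0 (Num.min 1 (A - `|x|)).

Lemma cutoff_itv A x : 0 <= cutoff A x <= 1.
Proof. by rewrite /cutoff le_max lexx/= ge_max ler01 ge_min lexx. Qed.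

Lemma cutoff0 (A x : R) : A <= `|x| -> cutoff A x = 0.
Proof.
move=> Ax; apply/max_idPl; rewrite ge_min; apply/orP; right.
by rewrite subr_le0.
Qed.

Lemma cutoff1 (A x : R) : `|x| <= A - 1 -> cutoff A x = 1.
Proof.
move=> xA; rewrite /cutoff (_ : Num.min 1 _ = 1); last first.
  by apply/min_idPl; rewrite lerBrDr addrC -lerBrDr.
by apply/max_idPr.
Qed.

Lemma continuous_cutoff A : continuous (cutoff A).
Proof.
have cnorm (u : R -> R) : continuous u -> continuous (fun x => `|u x|).
  by move=> cu x; apply: (cvg_comp u Num.norm (cu x)); exact: norm_continuous.
have cmin : continuous (fun x : R => Num.min 1 (A - `|x|)).
  under eq_fun do rewrite minr_absE.
  move=> x; apply: cvgM; last exact: cvg_cst.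
  have c1 : continuous (fun x : R => A - `|x|).
    by move=> y; apply: cvgB; [exact: cvg_cst|exact: norm_continuous].
  apply: cvgB; first by apply: cvgD; [exact: cvg_cst|exact: c1].
  apply: (cnorm (fun x => 1 - (A - `|x|))) => y.
  by apply: cvgB; [exact: cvg_cst|exact: c1].
rewrite /cutoff; under eq_fun do rewrite maxr_absE.
move=> x; apply: cvgM; last exact: cvg_cst.
apply: cvgD; first by apply: cvgD; [exact: cvg_cst|exact: cmin].
apply: (cnorm (fun x => 0 - Num.min 1 (A - `|x|))) => y.
by apply: cvgB; [exact: cvg_cst|exact: cmin].
Qed.

(** Chebyshev's inequality before integration; the radius [B + 1] makes the cutoff equal to 1 up to
    [B]. *)
Lemma one_sub_cutoff_le (B x : R) : 0 < B ->
  1 - cutoff (B + 1) x <= x ^+ 2 / B ^+ 2.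
Proof.
move=> B0; have /andP[c0 c1] := cutoff_itv (B + 1) x.
have [xB|Bx] := leP `|x| B.
  by rewrite cutoff1 ?addrK// subrr divr_ge0 ?sqr_ge0.
rewrite ler_pdivlMr ?exprn_gt0//; apply: (@le_trans _ _ (B ^+ 2)).
  by rewrite ler_piMl ?sqr_ge0// lerBlDr lerDl.
by rewrite -(real_normK (num_real x)) ler_sqr ?nnegrE// ltW.
Qed.

Lemma mean_cutoff_le (mu : law) f (M B : R) : continuous f ->
  (forall x, `|f x| <= M) -> 0 < B -> intg mu (fun x => x ^+ 2) ->
  `|\int[mu]_x f x - \int[mu]_x (f x * cutoff (B + 1) x)| <= M / B ^+ 2 * mom mu 2.
Proof.
move=> cf fM B0 i2.
have mf := measurable_continuous cf.
have mc := measurable_continuous (@continuous_cutoff (B + 1)).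
have fcM x : `|f x * cutoff (B + 1) x| <= M.
  have /andP[c0 c1] := cutoff_itv (B + 1) x.
  by rewrite normrM (ger0_norm c0) (le_trans _ (fM x))// ler_piMr.
have i1 : intg mu f by exact: (@intg_bounded _ _ _ mu f M mf fM).
have ic : intg mu (fun x => f x * cutoff (B + 1) x).
  by apply: (@intg_bounded _ _ _ mu _ M) => //; exact: measurable_funM.
rewrite -meanB// /mom -meanZ//; apply: le_norm_mean; [exact: intgB|exact: intgZ|].
move=> x; have -> : f x - f x * cutoff (B + 1) x = f x * (1 - cutoff (B + 1) x) by ring.
have /andP[c0 c1] := cutoff_itv (B + 1) x.
rewrite normrM (@ger0_norm _ (1 - _)) ?subr_ge0// mulrAC -mulrA.
by apply: ler_pM => //; [rewrite subr_ge0|exact: one_sub_cutoff_le].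
Qed.

(** This writes the limit law as a sum of [n] Gaussian terms, against which the summands are
    swapped. *)
Lemma convoln_normal_root n A : (0 < n)%N -> measurable A ->
  convoln (normal_prob 0 (Num.sqrt n%:R)^-1) n A = @normal_prob R 0 1 A.
Proof.
case: n => // n _ mA; rewrite convoln_normal_prob ?invr_gt0 ?sqrtr_gt0//.
by rewrite divff// gt_eqF// sqrtr_gt0.
Qed.

(** The hypothesis on [Phi] is Lindeberg's condition in disguise: for [eps <= 1], [Phi y] is at most
    [eps y^2] when [|y| <= eps] and lies between [eps y^2] and [y^2] otherwise. *)
Theorem array_clt (a : nat -> law) (k : nat -> nat) f (M : R) :
  (\forall d \near \oo, intg (a d) (fun x => x ^+ 2) /\ mom (a d) 1 = 0) ->
  (fun d => (k d)%:R * mom (a d) 2) @ \oo --> (1 : R) ->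
  (fun d => (k d)%:R * \int[a d]_x Phi x) @ \oo --> (0 : R) ->
  k @ \oo --> \oo -> continuous f -> (forall x, `|f x| <= M) ->
  (fun d => \int[convoln (a d) (k d)]_x f x) @ \oo --> \int[normal_prob 0 1]_x f x.
Proof.
move=> a2 v1 Phi0 koo cf fM; apply/cvgrPdist_le => e e0.
have M0 : 0 <= M by rewrite (le_trans _ (fM 0)).
(* Three comparisons cost [3 e1] each: [f] with [g] under the convolution power, the swap for [g],
   and [f] with [g] under the Gaussian law. *)
pose e1 := e / 9; have e10 : 0 < e1 by rewrite divr_gt0.
(* As [B >= 1], [B^2 >= B >= M / e1], which gives [MB]. *)
pose B := 1 + M / e1.
have B1 : 1 <= B by rewrite lerDl divr_ge0// ltW.
have B0 : 0 < B by rewrite (lt_le_trans _ B1).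
have MB : M / B ^+ 2 <= e1.
  rewrite ler_pdivrMr ?exprn_gt0//; apply: (@le_trans _ _ (e1 * B)).
    by rewrite /B mulrDr mulr1 mulrC divfK ?gt_eqF// lerDr ltW.
  by rewrite ler_wpM2l ?(ltW e10)// expr2 ler_peMl// ltW.
pose fc x := f x * cutoff (B + 1) x.
have cfc : continuous fc.
  by move=> x; apply: cvgM; [exact: cf|exact: continuous_cutoff].
have fcM x : `|fc x| <= M.
  have /andP[c0 c1] := cutoff_itv (B + 1) x.
  by rewrite normrM (ger0_norm c0) (le_trans _ (fM x))// ler_piMr.
have fc0 x : B + 1 < `|x| -> fc x = 0.
  by move=> xB; rewrite /fc cutoff0 ?mulr0// ltW.
have [g [K [cg gM gfc K0 gT]]] := smooth_approximation cfc fcM fc0 e10.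
have mg := measurable_continuous cg.
have mfc := measurable_continuous cfc.
(* Truncation costs [2 e1], by Chebyshev with second moment at most 2, and smoothing costs [e1]. *)
have close (mu : law) : intg mu (fun x => x ^+ 2) -> mom mu 2 <= 2 ->
    `|\int[mu]_x f x - \int[mu]_x g x| <= 3 * e1.
  move=> i2 m2.
  rewrite (le_trans (ler_distD (\int[mu]_x fc x) _ _))//.
  have h1 := mean_cutoff_le cf fM B0 i2.
  have h2 : `|\int[mu]_x fc x - \int[mu]_x g x| <= e1.
    have ig : intg mu g by exact: (@intg_bounded _ _ _ mu g M mg gM).
    have ifc : intg mu fc by exact: (@intg_bounded _ _ _ mu fc M mfc fcM).
    rewrite -meanB//; apply: le_norm_mean_cst; first exact: measurable_funB.
    by move=> x; rewrite distrC.
  have h3 : M / B ^+ 2 * mom mu 2 <= e1 * 2.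
    apply: ler_pM => //; first by rewrite divr_ge0// sqr_ge0.
    by apply: Rintegral_ge0 => x _; exact: sqr_ge0.
  rewrite (_ : 3 * e1 = e1 * 2 + e1); last by ring.
  by rewrite lerD// (le_trans h1).
have cP : (fun d => K * ((k d)%:R * \int[a d]_x Phi x)) @ \oo --> (0 : R).
  by rewrite -(mulr0 K); apply: cvgMr.
have cV : (fun d => (2 * M + K) * `|(k d)%:R * mom (a d) 2 - 1|) @ \oo --> (0 : R).
  rewrite -(mulr0 (2 * M + K)); apply: cvgMr; rewrite -(normr0 R) -(subrr (1 : R)).
  by apply: cvg_norm; apply: cvgB => //; exact: cvg_cst.
have nP : \forall d \near \oo, `|0 - K * ((k d)%:R * \int[a d]_x Phi x)| <= e1.
  by move/cvgrPdist_le : cP => /(_ e1 e10).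
have nV : \forall d \near \oo,
    `|0 - (2 * M + K) * `|(k d)%:R * mom (a d) 2 - 1| | <= e1.
  by move/cvgrPdist_le : cV => /(_ e1 e10).
have nv : \forall d \near \oo, `|1 - (k d)%:R * mom (a d) 2| <= 1.
  by move/cvgrPdist_le : v1 => /(_ 1 ltr01).
(* From [N] on, [4 K / sqrt (k d) <= e1], which bounds the Gaussian part of the swap error; the
   successor also makes [k d] positive. *)
pose N := (Num.bound ((4 * K / e1) ^+ 2)).+1.
near=> d.
have [i2 m1] : intg (a d) (fun x => x ^+ 2) /\ mom (a d) 1 = 0 by near: d.
have kN : (N <= k d)%N by near: d; exact: (koo _ (nbhs_infty_ge N)).
have v2 : `|1 - (k d)%:R * mom (a d) 2| <= 1.
  by near: d; exact: nv.
have hP : K * ((k d)%:R * \int[a d]_x Phi x) <= e1.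
  have : `|0 - K * ((k d)%:R * \int[a d]_x Phi x)| <= e1.
    by near: d; exact: nP.
  by rewrite sub0r normrN ler_norml => /andP[].
have hV : (2 * M + K) * `|(k d)%:R * mom (a d) 2 - 1| <= e1.
  have : `|0 - (2 * M + K) * `|(k d)%:R * mom (a d) 2 - 1| | <= e1.
    by near: d; exact: nV.
  by rewrite sub0r normrN ler_norml => /andP[].
have k0 : (0 < k d)%N by rewrite (leq_trans _ kN).
have kR0 : 0 < (k d)%:R :> R by rewrite ltr0n.
pose s : R := (Num.sqrt (k d)%:R)^-1.
have s0 : 0 < s by rewrite invr_gt0 sqrtr_gt0.
have ks : (k d)%:R * s ^+ 2 = 1.
  by rewrite exprVn sqr_sqrtr ?(ltW kR0)// divff ?gt_eqF.
have hK : 4 * K * s <= e1.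
  rewrite /s ler_pdivrMr ?sqrtr_gt0// -ler_pdivrMl// mulrC.
  rewrite -(@ger0_norm _ (4 * K / e1)); last first.
    by apply: divr_ge0; [exact: mulr_ge0|exact: ltW].
  rewrite -sqrtr_sqr; apply: ler_wsqrtr.
  have b0 : 0 <= (4 * K / e1) ^+ 2 by exact: sqr_ge0.
  apply: le_trans (ltW (archi_boundP b0)) _.
  by rewrite ler_nat (leq_trans _ kN).
have [n1 n2 _ _] := mom_normal s0.
have ni2 : intg (normal_prob 0 s) (fun x => x ^+ 2) by exact: intg_normal_pow.
have normE h : \int[normal_prob 0 1]_x h x = \int[convoln (normal_prob 0 s) (k d)]_x h x.
  by apply: eq_law_mean => A mA; rewrite convoln_normal_root.
have swap := @convoln_swap (a d) (normal_prob 0 s) g M _ mg gM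
  (fun x => taylor2_mean x mg gM K0 gT i2 m1 ni2 n1) (k d) 0.
have gswap : `|\int[convoln (a d) (k d)]_x g x - \int[normal_prob 0 1]_x g x| <= 3 * e1.
  rewrite normE.
  have e' (c : law) : \int[c]_x g x = \int[c]_x g (0 + x).
    by apply: eq_Rintegral => x _; rewrite add0r.
  rewrite !e'; apply: (le_trans swap).
  have hphi := normal_Phi_le s0.
  have kphi : (k d)%:R * (K * \int[normal_prob 0 s]_y Phi y) <= e1.
    apply: le_trans hK; rewrite mulrCA.
    have -> : 4 * K * s = K * ((k d)%:R * (4 * s ^+ 3)).
      by rewrite (_ : (k d)%:R * _ = ((k d)%:R * s ^+ 2) * (4 * s)); [rewrite ks; ring|ring].
    by rewrite ler_wpM2l// ler_wpM2l// ltW.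
  have kv : (k d)%:R * ((2 * M + K) * `|mom (a d) 2 - mom (normal_prob 0 s) 2|) <= e1.
    apply: le_trans hV; rewrite mulrCA n2.
    by rewrite -[X in X * `|_|](ger0_norm (ltW kR0)) -normrM mulrBr ks.
  rewrite mulrDr mulrDr mulrDr.
  rewrite (_ : 3 * e1 = e1 + e1 + e1); last by ring.
  by rewrite !lerD// mulrCA.
have [ci2 _ cm2] := moments2_convoln (k d) i2 m1.
have cl1 : `|\int[convoln (a d) (k d)]_x f x - \int[convoln (a d) (k d)]_x g x| <= 3 * e1.
  apply: close => //; rewrite cm2.
  by clear -v2; move: v2; rewrite ler_norml => /andP[? ?]; lra.
have [_ l2 _ _] := mom_normal (@ltr01 R).
have cl2 : `|\int[normal_prob 0 1]_x f x - \int[normal_prob 0 1]_x g x| <= 3 * e1.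
  by apply: close; [exact: intg_normal_pow|rewrite l2 expr1n ler1n].
rewrite (_ : _ - _ =
  (\int[normal_prob 0 1]_x f x - \int[normal_prob 0 1]_x g x) -
  (\int[convoln (a d) (k d)]_x g x - \int[normal_prob 0 1]_x g x) -
  (\int[convoln (a d) (k d)]_x f x - \int[convoln (a d) (k d)]_x g x)); last by ring.
have -> : e = 3 * e1 + 3 * e1 + 3 * e1 by rewrite /e1; field.
by rewrite (le_trans (ler_normB _ _))// lerD// (le_trans (ler_normB _ _))// lerD.
Unshelve. all: by end_near. Qed.

End ArrayCLT.

(** * Fourth powers of the columns *)

Section Lindeberg.
Context {R : realType}.
Local Notation law := (probability (measurableTypeR R) R).

Definition scale (c : R) (x : measurableTypeR R) : measurableTypeR R := c * x.

Lemma measurable_scale c : measurable_fun setT (scale c).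
Proof. exact: measurable_funM. Qed.

HB.instance Definition _ c := isMeasurableFun.Build _ _ _ _ (scale c)
  (measurable_scale c).

Definition sqdev (c : R) (x : measurableTypeR R) : measurableTypeR R :=
  c * (x ^+ 2 - 1).

Lemma measurable_sqdev c : measurable_fun setT (sqdev c).
Proof.
by apply: measurable_funM => //; apply: measurable_funB.
Qed.

HB.instance Definition _ c := isMeasurableFun.Build _ _ _ _ (sqdev c)
  (measurable_sqdev c).

Lemma intg_scale (a : law) c k : intg a (fun x => x ^+ k) ->
  intg (distribution a (scale c)) (fun x => x ^+ k).
Proof.
move=> ik; apply: intg_distribution; first exact: exprn_measurable.
by apply: eq_integrable (intgZ (c ^+ k) ik) => // x _ /=; rewrite exprMn.
Qed.

Lemma mom_scale (a : law) c k : intg a (fun x => x ^+ k) ->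
  mom (distribution a (scale c)) k = c ^+ k * mom a k.
Proof.
move=> ik; rewrite /mom -meanZ// mean_distribution.
- by apply: eq_Rintegral => x _; rewrite exprMn.
- exact: exprn_measurable.
- by apply: eq_integrable (intgZ (c ^+ k) ik) => // x _ /=; rewrite exprMn.
Qed.

Lemma invr_sqrt_cvg0 (k : nat -> nat) : k @ \oo --> \oo ->
  (fun d => (Num.sqrt (k d)%:R)^-1) @ \oo --> (0 : R).
Proof.
move=> koo; apply/cvgrPdist_le => e e0.
pose N := (Num.bound (e^-1 ^+ 2)).+1; near=> d.
have kN : (N <= k d)%N by near: d; exact: (koo _ (nbhs_infty_ge N)).
rewrite sub0r normrN ger0_norm ?invr_ge0 ?sqrtr_ge0//.
rewrite -[leRHS]invrK lef_pV2 ?posrE ?invr_gt0 ?sqrtr_gt0 ?ltr0n//; last first.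
  exact: leq_trans kN.
have -> : e^-1 = Num.sqrt (e^-1 ^+ 2) by rewrite sqrtr_sqr ger0_norm// invr_ge0 ltW.
apply: ler_wsqrtr.
have b0 : 0 <= e^-1 ^+ 2 by exact: sqr_ge0.
by rewrite (le_trans (ltW (archi_boundP b0)))// ler_nat (leq_trans _ kN).
Unshelve. all: by end_near. Qed.

Section column.
Context (mu : law) (n : nat -> nat).
Hypotheses (mu4 : intg mu (fun x => x ^+ 4)) (mu1 : mom mu 1 = 0)
  (mu2 : mom mu 2 = 1) (n_oo : n @ \oo --> \oo).

Definition entry_law d : law := distribution mu (scale (Num.sqrt (n d)%:R)^-1).

(** The law of the overview's [T] for [n = n d]. *)
Definition column_law d : law := convoln (entry_law d) (n d).

Let n_gt0 : \forall d \near \oo, (0 < n d)%N.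
Proof. exact: (n_oo (nbhs_infty_ge 1%N)). Qed.

Let entry4 d : intg (entry_law d) (fun x => x ^+ 4).
Proof. exact: intg_scale. Qed.

Let entry1 d : mom (entry_law d) 1 = 0.
Proof. by rewrite mom_scale ?mu1 ?mulr0//; exact: intg_pow4. Qed.

Let entry2 d : mom (entry_law d) 2 = (n d)%:R^-1.
Proof.
rewrite mom_scale ?mu2 ?mulr1; last exact: intg_pow4.
by rewrite exprVn sqr_sqrtr.
Qed.

(** Here the cubic bound is enough, with [|x|^3 <= 1 + x^4]: of [c^3], two factors cancel [n d] and
    one is left to tend to 0. *)
Let entry_Phi d : (0 < n d)%N -> (n d)%:R * \int[entry_law d]_x Phi x <=
  (Num.sqrt (n d)%:R)^-1 * (1 + mom mu 4).
Proof.
move=> nd0; set c := (Num.sqrt _)^-1.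
have c0 : 0 < c by rewrite invr_gt0 sqrtr_gt0 ltr0n.
have nc : (n d)%:R * c ^+ 2 = 1.
  by rewrite exprVn sqr_sqrtr// divff// pnatr_eq0 -lt0n.
have iPhi : intg mu (fun x => Phi (scale c x)).
  apply: (@intg_le _ (measurableTypeR R) _ mu _ (fun x : R => c ^+ 2 * x ^+ 2)).
  - by apply: measurableT_comp; [exact: measurable_Phi|exact: measurable_scale].
  - by move=> x; rewrite ger0_norm ?Phi_ge0// (le_trans (Phi_le_sqr _))// exprMn.
  - by apply: intgZ; exact: intg_pow4.
rewrite mean_distribution//; last exact: measurable_Phi.
have i1 : intg mu (fun x => c ^+ 3 * (1 + x ^+ 4)).
  by apply: intgZ; apply: intgD => //; exact: intg_cst.
apply: (@le_trans _ _ ((n d)%:R * \int[mu]_x (c ^+ 3 * (1 + x ^+ 4)))).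
  rewrite ler_wpM2l//; apply: le_mean => // x.
  rewrite (le_trans (Phi_le_cube _))// /scale normrM (gtr0_norm c0) exprMn.
  rewrite ler_wpM2l ?exprn_ge0 ?(ltW c0)//.
  have -> : x ^+ 4 = `|x| ^+ 4 by rewrite -normrX ger0_norm// (exprM x 2 2) sqr_ge0.
  have [x1|x1] := leP `|x| 1.
    by rewrite (@le_trans _ _ 1) ?exprn_ile1// lerDl exprn_ge0.
  by rewrite (le_trans (ler_weXn2l (ltW x1) (isT : (3 <= 4)%N)))// lerDr.
rewrite meanZ; last by apply: intgD => //; exact: intg_cst.
rewrite meanD//; last exact: intg_cst.
rewrite mean_cst -/(mom mu 4) mulrA.
by rewrite exprSr mulrA nc mul1r.
Qed.

Lemma column_clt f (M : R) : continuous f -> (forall x, `|f x| <= M) ->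
  (fun d => \int[column_law d]_x f x) @ \oo --> \int[normal_prob 0 1]_x f x.
Proof.
move=> cf fM; apply: (@array_clt R entry_law n f M) => //.
- by apply: nearW => d; split; [exact: intg_pow4|exact: entry1].
- apply: cvg_near_cst; near=> d; rewrite entry2 divff// pnatr_eq0 -lt0n.
  by near: d.
- apply: (@squeeze_cvgr _ _ _ _ (cst 0) (fun d => (Num.sqrt (n d)%:R)^-1 * (1 + mom mu 4))).
  + near=> d; rewrite entry_Phi ?andbT; last by near: d.
    by rewrite mulr_ge0//; apply: Rintegral_ge0 => x _; exact: Phi_ge0.
  + exact: cvg_cst.
  + rewrite -(mul0r (1 + mom mu 4)); apply: cvgMl; exact: invr_sqrt_cvg0.
Unshelve. all: by end_near. Qed.

(** The excess kurtosis of a normalized sum is that of one term divided by the number of terms. *)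
Lemma column_moments d : (0 < n d)%N ->
  [/\ intg (column_law d) (fun x => x ^+ 4), mom (column_law d) 2 = 1 &
    mom (column_law d) 4 = 3 + (mom mu 4 - 3) / (n d)%:R].
Proof.
move=> nd0; have nR0 : (n d)%:R != 0 :> R by rewrite pnatr_eq0 -lt0n.
have [i4 _ -> ->] := moments_convoln (n d) (entry4 d) (entry1 d).
rewrite entry2 divff//; split => //; rewrite mom_scale// exprVn.
by rewrite (exprM _ 2 2) sqr_sqrtr//; field.
Qed.

Lemma column_mom4_cvg : (fun d => mom (column_law d) 4) @ \oo --> (3 : R).
Proof.
have : (fun d => 3 + (mom mu 4 - 3) * (Num.sqrt (n d)%:R)^-1 ^+ 2) @ \oo --> (3 : R).
  have sq0 : (fun d => (Num.sqrt (n d)%:R)^-1 ^+ 2) @ \oo --> (0 : R).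
    rewrite -(mulr0 (0 : R)); under eq_fun do rewrite expr2.
    by apply: cvgM; exact: invr_sqrt_cvg0.
  rewrite -[X in _ --> X]addr0 -[X in 3 + X](mulr0 (mom mu 4 - 3)).
  by apply: cvgD; [exact: cvg_cst|exact: cvgMr].
apply: cvg_trans; apply: near_eq_cvg; near=> d.
have nd0 : (0 < n d)%N by near: d.
by have [_ _ ->] := column_moments nd0; rewrite exprVn sqr_sqrtr.
Unshelve. all: by end_near. Qed.

Definition summand_law d : law :=
  distribution (column_law d) (sqdev (Num.sqrt (2 * d%:R))^-1).

(* Uniform integrability of the fourth powers follows from the column CLT
   together with the convergence of the fourth moments. *)
Let tail d B := mom (column_law d) 4 -
  \int[column_law d]_x (x ^+ 4 * cutoff (B + 1) x).

(** The truncated fourth power is bounded and continuous, so [column_clt] applies to it. The tails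
    therefore converge to the Gaussian tail, which is at most the sixth moment 15 over [B^2]. *)
Let tail_cvg B : 0 < B -> exists2 l : R, l <= 15 / B ^+ 2 &
  (fun d => tail d B) @ \oo --> l.
Proof.
move=> B0; pose h (x : R) := x ^+ 4 * cutoff (B + 1) x.
have ch : continuous h.
  by move=> x; apply: cvgM; [exact: exprn_continuous|exact: continuous_cutoff].
have hM x : `|h x| <= (B + 1) ^+ 4.
  have /andP[c0 c1] := cutoff_itv (B + 1) x.
  have [xB|xB] := leP (B + 1) `|x|.
    by rewrite /h cutoff0// mulr0 normr0 exprn_ge0// addr_ge0// ltW.
  rewrite normrM (ger0_norm c0) normrX (@le_trans _ _ (`|x| ^+ 4))//.
    by rewrite ler_piMr ?exprn_ge0.
  by rewrite lerXn2r ?nnegrE ?(ltW xB)// addr_ge0// ltW.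
have i4 : intg (normal_prob 0 (1 : R)) (fun x => x ^+ 4) by exact: intg_normal_pow.
have ih : intg (normal_prob 0 (1 : R)) h.
  exact: (@intg_bounded _ (measurableTypeR R) _ (normal_prob 0 1) h _
    (measurable_continuous ch) hM).
have [_ _ m4 m6] := mom_normal (@ltr01 R).
exists (3 - \int[normal_prob 0 1]_x h x).
  rewrite -[X in X - _](_ : mom (normal_prob 0 1) 4 = 3); last by rewrite m4 expr1n mulr1.
  rewrite /mom -meanB//.
  rewrite [leRHS](_ : _ = (B ^+ 2)^-1 * mom (normal_prob 0 1) 6); last first.
    by rewrite m6 expr1n mulr1 mulrC.
  rewrite /mom -meanZ; last exact: intg_normal_pow.
  apply: le_mean; [exact: intgB|by apply: intgZ; exact: intg_normal_pow|move=> x].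
  have -> : x ^+ 4 - h x = x ^+ 4 * (1 - cutoff (B + 1) x) by rewrite /h; ring.
  have -> : (B ^+ 2)^-1 * x ^+ 6 = x ^+ 4 * (x ^+ 2 / B ^+ 2).
    by rewrite (exprD x 4 2); ring.
  rewrite ler_wpM2l//; first by rewrite (exprM x 2 2) sqr_ge0.
  exact: one_sub_cutoff_le.
by apply: cvgB; [exact: column_mom4_cvg|exact: (column_clt ch hM)].
Qed.

(** For [|x| < A] the cubic bound gains a factor of order [d^(-1/2)]. For [|x| >= A] the quadratic
    bound leaves at most [x^4], and the cutoff vanishes there. Both use that [d] times the squared
    scale is 1/2. *)
Let Phi_sqdev_le (d : nat) (A x : R) : (0 < d)%N -> 1 <= A ->
  d%:R * Phi (sqdev (Num.sqrt (2 * d%:R))^-1 x) <=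
  A ^+ 6 * (Num.sqrt d%:R)^-1 + (x ^+ 4 - x ^+ 4 * cutoff A x).
Proof.
move=> d0 A1; have dR0 : 0 < d%:R :> R by rewrite ltr0n.
set e := (Num.sqrt (2 * _))^-1.
have e0 : 0 < e by rewrite invr_gt0 sqrtr_gt0 mulr_gt0.
have de : d%:R * e ^+ 2 = 2^-1.
  rewrite exprVn sqr_sqrtr ?mulr_ge0//; field; exact: lt0r_neq0.
have ed : e <= (Num.sqrt d%:R)^-1.
  rewrite lef_pV2 ?posrE ?sqrtr_gt0 ?mulr_gt0//; apply: ler_wsqrtr.
  by rewrite ler_peMl// ler1n.
have /andP[c0 c1] := cutoff_itv A x.
have x40 : 0 <= x ^+ 4 by rewrite (exprM x 2 2) sqr_ge0.
have xx : x ^+ 2 = `|x| ^+ 2 by rewrite real_normK ?num_real.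
have [Ax|xA] := leP A `|x|.
  have x1 : 1 <= x ^+ 2 by rewrite xx expr_ge1// (le_trans A1).
  rewrite cutoff0// mulr0 subr0 (@le_trans _ _ (x ^+ 4))//; last first.
    rewrite lerDr mulr_ge0 ?invr_ge0 ?sqrtr_ge0// exprn_ge0//.
    by rewrite (le_trans _ A1).
  apply: (@le_trans _ _ (d%:R * (e ^+ 2 * (x ^+ 2 - 1) ^+ 2))).
    by rewrite ler_wpM2l ?(ltW dR0)// (le_trans (Phi_le_sqr _))// exprMn.
  rewrite mulrA de (exprM x 2 2).
  apply: (@le_trans _ _ ((x ^+ 2 - 1) ^+ 2)).
    by rewrite ler_piMl ?sqr_ge0// invf_le1// ler1n.
  by rewrite lerXn2r ?nnegrE ?subr_ge0 ?sqr_ge0// lerBlDr lerDl.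
rewrite -[leLHS]addr0; apply: lerD; last first.
  by rewrite subr_ge0 ler_piMr.
have xA2 : `|x ^+ 2 - 1| <= A ^+ 2.
  have x2 : x ^+ 2 <= A ^+ 2.
    by rewrite xx lerXn2r ?nnegrE ?(ltW xA)// (le_trans _ A1).
  have A2 : 1 <= A ^+ 2 by rewrite expr_ge1// (le_trans _ A1).
  have := sqr_ge0 x; rewrite ler_norml => ?; apply/andP; split; lra.
apply: (@le_trans _ _ (d%:R * (e ^+ 3 * (A ^+ 2) ^+ 3))).
  rewrite ler_wpM2l ?(ltW dR0)// (le_trans (Phi_le_cube _))//.
  rewrite normrM (gtr0_norm e0) exprMn ler_wpM2l ?exprn_ge0 ?(ltW e0)//.
  by rewrite lerXn2r ?nnegrE ?sqr_ge0.
have -> : d%:R * (e ^+ 3 * (A ^+ 2) ^+ 3) = A ^+ 6 * (d%:R * e ^+ 2 * e).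
  by rewrite -exprM; ring.
rewrite de ler_wpM2l ?exprn_ge0 ?(le_trans _ A1)//.
by rewrite (le_trans _ ed)// ler_piMl ?(ltW e0)// invf_le1// ler1n.
Qed.

Let intg_sqdev_pow d c k : (k <= 2)%N -> (0 < n d)%N ->
  intg (column_law d) (fun x => sqdev c x ^+ k).
Proof.
move=> k2 nd0; have [i4 _ _] := column_moments nd0.
have i2 : intg (column_law d) (fun x => sqdev c x ^+ 2).
  have : intg (column_law d) (fun x => c ^+ 2 * (x ^+ 4 - 2 * x ^+ 2 + 1)).
    apply: intgZ; apply: intgD; last exact: intg_cst.
    by apply: intgB => //; apply: intgZ; exact: intg_pow4.
  by apply: eq_integrable => // x _ /=; congr EFin; rewrite /sqdev; ring.
apply: (@intg_pow_le _ _ _ (column_law d) (sqdev c) k 1) => //.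
exact: measurable_sqdev.
Qed.

(** The right side is half the variance of [T^2]. It tends to [(3 - 1) / 2 = 1], which explains the
    2 in the normalization. *)
Let summand_moments d : (0 < d)%N -> (0 < n d)%N ->
  [/\ intg (summand_law d) (fun x => x ^+ 2), mom (summand_law d) 1 = 0 &
    d%:R * mom (summand_law d) 2 = (mom (column_law d) 4 - 1) / 2].
Proof.
move=> d0 nd0; have [i4 m2 _] := column_moments nd0.
have dR0 : 0 < d%:R :> R by rewrite ltr0n.
have i2 : intg (column_law d) (fun x => x ^+ 2) by exact: intg_pow4.
rewrite /summand_law; set c := (Num.sqrt (2 * d%:R))^-1.
have one : intg (column_law d) (cst 1) by exact: intg_cst.
split.
- apply: intg_distribution; first exact: exprn_measurable.
  exact: intg_sqdev_pow.
- rewrite /mom mean_distribution; [|exact: exprn_measurable|exact: intg_sqdev_pow].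
  under eq_Rintegral do rewrite expr1 /sqdev.
  rewrite meanZ; last exact: intgB.
  by rewrite meanB// mean_cst -/(mom _ 2) m2 subrr mulr0.
- rewrite {1}/mom mean_distribution; [|exact: exprn_measurable|exact: intg_sqdev_pow].
  have -> : \int[column_law d]_x (sqdev c x ^+ 2) =
      \int[column_law d]_x (c ^+ 2 * (x ^+ 4 - 2 * x ^+ 2 + 1)).
    by apply: eq_Rintegral => x _; rewrite /sqdev; ring.
  have i22 : intg (column_law d) (fun x => 2 * x ^+ 2) by exact: intgZ.
  rewrite meanZ; last by apply: intgD => //; exact: intgB.
  rewrite meanD//; last exact: intgB.
  rewrite meanB// meanZ// mean_cst -/(mom _ 2) -/(mom _ 4) m2.
  rewrite /c exprVn sqr_sqrtr ?mulr_ge0//; field; exact: lt0r_neq0.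
Qed.

Lemma sum_clt f (M : R) : continuous f -> (forall x, `|f x| <= M) ->
  (fun d => \int[convoln (summand_law d) d]_x f x) @ \oo -->
  \int[normal_prob 0 1]_x f x.
Proof.
move=> cf fM; apply: (@array_clt R summand_law id f M) => //.
- near=> d; have nd0 : (0 < n d)%N by near: d.
  have d0 : (0 < d)%N by near: d; exact: nbhs_infty_gt.
  by have [] := summand_moments d0 nd0.
- have : (fun d => (mom (column_law d) 4 - 1) / 2) @ \oo --> (1 : R).
    rewrite [X in _ --> X](_ : 1 = (3 - 1) / 2); last by field.
    apply: cvgM; last exact: cvg_cst.
    by apply: cvgB; [exact: column_mom4_cvg|exact: cvg_cst].
  apply: cvg_trans; apply: near_eq_cvg; near=> d.
  have nd0 : (0 < n d)%N by near: d.
  have d0 : (0 < d)%N by near: d; exact: nbhs_infty_gt.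
  by have [_ _ ->] := summand_moments d0 nd0.
(* One third each for the term in [d^(-1/2)], the limiting tail, and the distance of the tail to its
   limit. [B] is fixed before [d] is taken large. *)
apply/cvgrPdist_le => e e0; pose e1 := e / 3.
have e10 : 0 < e1 by rewrite divr_gt0.
pose B := 1 + 15 / e1.
have B1 : 1 <= B by rewrite lerDl divr_ge0// ltW.
have B0 : 0 < B by rewrite (lt_le_trans _ B1).
have BB : 15 / B ^+ 2 <= e1.
  rewrite ler_pdivrMr ?exprn_gt0//; apply: (@le_trans _ _ (e1 * B)).
    by rewrite /B mulrDr mulr1 mulrC divfK ?gt_eqF// lerDr ltW.
  by rewrite ler_wpM2l ?(ltW e10)// expr2 ler_peMl// ltW.
have [l lB tl] := tail_cvg B0.
have tl1 : \forall d \near \oo, `|l - tail d B| <= e1.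
  by move/cvgrPdist_le : tl => /(_ e1 e10).
have sd : (fun d => (B + 1) ^+ 6 * (Num.sqrt d%:R)^-1) @ \oo --> (0 : R).
  by rewrite -(mulr0 ((B + 1) ^+ 6)); apply: cvgMr; exact: invr_sqrt_cvg0.
have sd1 : \forall d \near \oo, `|0 - (B + 1) ^+ 6 * (Num.sqrt d%:R)^-1| <= e1.
  by move/cvgrPdist_le : sd => /(_ e1 e10).
near=> d; have nd0 : (0 < n d)%N by near: d.
have d0 : (0 < d)%N by near: d; exact: nbhs_infty_gt.
have [i4 _ _] := column_moments nd0.
have tld : `|l - tail d B| <= e1 by near: d.
have sdd : `|0 - (B + 1) ^+ 6 * (Num.sqrt d%:R)^-1| <= e1 by near: d.
have A1 : 1 <= B + 1 by rewrite lerDr ltW.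
rewrite sub0r normrN ger0_norm; last first.
  by rewrite mulr_ge0//; apply: Rintegral_ge0 => x _; exact: Phi_ge0.
have ic : intg (column_law d) (fun x => x ^+ 4 * cutoff (B + 1) x).
  apply: (@intg_le _ (measurableTypeR R) _ (column_law d) _ (fun x : R => x ^+ 4)); last exact: i4.
    apply: measurable_funM; first exact: exprn_measurable.
    exact: (measurable_continuous (@continuous_cutoff R (B + 1))).
  move=> x; have /andP[c0 c1] := cutoff_itv (B + 1) x.
  have x40 : 0 <= x ^+ 4 by rewrite (exprM x 2 2) sqr_ge0.
  by rewrite ger0_norm; [exact: ler_piMr|exact: mulr_ge0].
have iPhi : intg (column_law d) (fun x => Phi (sqdev (Num.sqrt (2 * d%:R))^-1 x)).
  apply: (@intg_le _ (measurableTypeR R) _ (column_law d) _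
    (fun x : R => sqdev (Num.sqrt (2 * d%:R))^-1 x ^+ 2)).
  - by apply: measurableT_comp; [exact: measurable_Phi|exact: measurable_sqdev].
  - by move=> x; rewrite ger0_norm ?Phi_ge0 ?Phi_le_sqr.
  - exact: intg_sqdev_pow.
rewrite mean_distribution//; last exact: measurable_Phi.
rewrite -meanZ//.
have itail : intg (column_law d) (fun x => x ^+ 4 - x ^+ 4 * cutoff (B + 1) x).
  exact: intgB.
apply: (@le_trans _ _ (\int[column_law d]_x ((B + 1) ^+ 6 * (Num.sqrt d%:R)^-1 +
    (x ^+ 4 - x ^+ 4 * cutoff (B + 1) x)))).
  apply: le_mean; [exact: intgZ|by apply: intgD => //; exact: intg_cst|].
  by move=> x; exact: Phi_sqdev_le.
rewrite meanD//; last exact: intg_cst.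
rewrite mean_cst meanB//.
have -> : e = e1 + (e1 + e1) by rewrite /e1; field.
apply: lerD.
  by move: sdd; rewrite sub0r normrN; exact: le_trans (ler_norm _).
rewrite -/(tail d B).
rewrite (_ : tail d B = l + (tail d B - l)); last by rewrite addrC subrK.
rewrite lerD ?(le_trans lB)//.
by move: tld; rewrite distrC; exact: le_trans (ler_norm _).
Unshelve. all: by end_near. Qed.

End column.
End Lindeberg.

(** * From random variables to their laws, and the conclusion *)

Section HasLaw.
Context (disp : measure_display) (T : measurableType disp) (R : realType).
Context (P : probability T R).
Local Notation law := (probability (measurableTypeR R) R).

Lemma has_law_comp (U : T -> R) (a : law)
    (phi : {mfun measurableTypeR R >-> measurableTypeR R}) :
  has_law P U a -> has_law P (phi \o U) (distribution a phi).
Proof.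
move=> [mU aU]; split; first exact: (measurableT_comp (measurable_funPT phi) mU).
move=> A mA; rewrite comp_preimage; apply: aU.
by rewrite -[X in measurable X]setTI; exact: (measurable_funP phi).
Qed.

Lemma measurable_borel_rv (X : {RV P >-> R}) :
  measurable_fun setT (X : T -> measurableTypeR R).
Proof. by move=> mT A mA; exact: (measurable_funPT X mT A mA). Qed.

(* R carries several convertible measurable structures; laws live on measurableTypeR R. *)
Definition borel_rv (X : {RV P >-> R}) : {mfun T >-> measurableTypeR R} :=
  HB.pack (X : T -> measurableTypeR R)
    (isMeasurableFun.Build _ _ _ _ _ (measurable_borel_rv X)).

Lemma expectation_has_law (Z : {RV P >-> R}) (a : law) (f : R -> R) (M : R) :
  has_law P Z a -> measurable_fun setT f -> (forall x, `|f x| <= M) ->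
  ('E_P[f \o Z] = (\int[a]_x f x)%R%:E)%E.
Proof.
move=> [mZ aZ] mf fM; rewrite unlock -EFin_mean; last first.
  exact: (@intg_bounded _ (measurableTypeR R) _ a f M).
pose nu : law := distribution P (borel_rv Z).
transitivity (\int[nu]_x (f x)%:E)%E; last first.
  by apply: eq_measure_integral => A mA _; exact: aZ.
rewrite /nu integral_distribution//; first exact/measurable_EFinP.
apply: (@intg_bounded _ _ _ P (f \o Z) M); first exact: (measurableT_comp mf mZ).
by move=> w; exact: fM.
Qed.

(** The denominator equals [(n / d) sqrt (2 d)]. Dividing [S_j^2 / d - n / d] by it gives
    [(S_j^2 / n - 1) / sqrt (2 d)] for each coordinate. *)
Lemma normalized_sqnormE (xi : nat -> nat -> {RV P >-> R}) (d n : nat) w :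
  (0 < d)%N -> (0 < n)%N -> normalized_sqnorm xi d n w =
  \sum_(j < d) sqdev (Num.sqrt (2 * d%:R))^-1
    (\sum_(i < n) scale (Num.sqrt n%:R)^-1 (xi i j w)).
Proof.
move=> d0 n0; have dR0 : 0 < d%:R :> R by rewrite ltr0n.
have nR0 : 0 < n%:R :> R by rewrite ltr0n.
pose S j := \sum_(i < n) xi i j w.
have sqrt_inv2 (m : R) : 0 < m -> (Num.sqrt m)^-1 ^+ 2 = m^-1.
  by move=> m0; rewrite exprVn sqr_sqrtr// ltW.
have walkE (j : 'I_d) : walk xi d n w ord0 j = (Num.sqrt d%:R)^-1 * S j.
  rewrite /walk summxE mulr_sumr; apply: eq_bigr => i _.
  by rewrite /step !mxE.
rewrite /normalized_sqnorm /enorm sqr_sqrtr; last first.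
  by apply: sumr_ge0 => j _; exact: sqr_ge0.
under eq_bigr do rewrite walkE exprMn sqrt_inv2//.
rewrite -mulr_sumr.
have -> : \sum_(j < d) sqdev (Num.sqrt (2 * d%:R))^-1
    (\sum_(i < n) scale (Num.sqrt n%:R)^-1 (xi i j w)) =
    (Num.sqrt (2 * d%:R))^-1 * (n%:R^-1 * \sum_(j < d) S j ^+ 2 - d%:R).
  transitivity (\sum_(j < d) (Num.sqrt (2 * d%:R))^-1 * (n%:R^-1 * S j ^+ 2 - 1)).
    apply: eq_bigr => j _; rewrite /sqdev -mulr_sumr exprMn sqrt_inv2//.
  by rewrite -mulr_sumr sumrB -mulr_sumr sumr_const card_ord.
have -> : Num.sqrt (2 * n%:R ^+ 2 / d%:R) = n%:R / d%:R * Num.sqrt (2 * d%:R) :> R.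
  rewrite -[X in X * Num.sqrt _]ger0_norm ?divr_ge0 ?ltW// -sqrtr_sqr -sqrtrM ?sqr_ge0//.
  by congr Num.sqrt; field; exact: lt0r_neq0.
have : Num.sqrt (2 * d%:R) != 0 :> R by rewrite lt0r_neq0// sqrtr_gt0 mulr_gt0.
move: (Num.sqrt (2 * d%:R)) (\sum_(j < d) S j ^+ 2) => q s q0.
by field; rewrite q0 !lt0r_neq0.
Qed.

End HasLaw.

Theorem theorem3p1 (R : realType)
    (disp0 : measure_display) (T0 : measurableType disp0)
    (P0 : probability T0 R) (xi0 : {RV P0 >-> R})
    (disp : measure_display) (T : measurableType disp)
    (P : probability T R) (xi : nat -> nat -> {RV P >-> R})
    (n : nat -> nat)
    (xi_iid : independent_copies P P0 xi xi0)
    (mean0 : ('E_P0[xi0] = 0)%E)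
    (moment2 : ('E_P0[(fun w => xi0 w ^+ 2)%R] = 1)%E)
    (moment4 : ('E_P0[(fun w => xi0 w ^+ 4)%R] < +oo)%E)
    (n_gt0 : forall d, (0 < d)%N -> (0 < n d)%N)
    (n_oo : n d @[d --> \oo] --> \oo) :
  cvg_in_distribution P (fun d => normalized_sqnorm xi d (n d))
    (normal_prob 0 1).
Proof.
have [indep same] := xi_iid.
pose mu : probability (measurableTypeR R) R :=
  distribution P0 (borel_rv xi0).
have xi_law i j : has_law P (xi i j) mu.
  by split => // A mA; exact: same.
have i4 : intg P0 (fun w => xi0 w ^+ 4).
  apply/integrableP; split.
    by apply/measurable_EFinP; exact: measurable_funX.
  move: moment4; rewrite unlock; congr (_ < _)%E.
  apply: eq_integral => w _ /=.
  by rewrite ger0_norm// (exprM _ 2 2) sqr_ge0.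
have ik k : (k <= 4)%N -> intg P0 (fun w => xi0 w ^+ k).
  by move=> k4; exact: (@intg_pow_le _ _ _ P0 xi0 k 2).
have momE k : (k <= 4)%N -> mom mu k = \int[P0]_w (xi0 w ^+ k).
  by move=> k4; rewrite /mom mean_distribution//; exact: ik.
have mu4 : intg mu (fun x => x ^+ 4).
  by apply: intg_distribution => //; exact: exprn_measurable.
have mu1 : mom mu 1 = 0.
  rewrite momE// /Rintegral; move: mean0; rewrite unlock => /(congr1 fine) /= <-.
  by congr fine; apply: eq_integral.
have mu2 : mom mu 2 = 1.
  by rewrite momE// /Rintegral; move: moment2; rewrite unlock => ->.
have sqnorm_law d : (0 < d)%N ->
    has_law P (normalized_sqnorm xi d (n d)) (convoln (summand_law mu n d) d).
  move=> d0; pose c : R := (Num.sqrt (n d)%:R)^-1.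
  have cell (j : nat) : trivIset setT (fun i : nat => [set (i, j)]).
    by move=> i i' _ _ [x [-> [->]]].
  (* First use of [has_law_sum]: the blocks are single cells of column [j]. *)
  have column j : block_measurable (fun ij : nat * nat => xi ij.1 ij.2)
        (\bigcup_(i in `I_(n d)) [set (i, j)])
        (fun w => \sum_(i < n d) scale c (xi i j w)) /\
      has_law P (fun w => \sum_(i < n d) scale c (xi i j w)) (column_law mu n d).
    apply: (has_law_sum (U := fun i w => scale c (xi i j w)) (a := entry_law mu n d)
      indep _ (cell j)) => i.
      apply: (measurableT_comp (measurable_scale c)).
      exact: (@block_measurable1 _ _ _ P _ (fun ij : nat * nat => xi ij.1 ij.2) (i, j)).
    exact: (has_law_comp (scale c) (xi_law i j)).
  have columns : trivIset setT (fun j : nat => \bigcup_(i in `I_(n d)) [set (i, j)]).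
    by move=> j j' _ _ [x [[i _ ->] [i' _ [_ ->]]]].
  pose e : R := (Num.sqrt (2 * d%:R))^-1.
  (* Second use: the blocks are whole columns, pairwise disjoint by [columns]. *)
  have [j|j|_] := has_law_sum (a := summand_law mu n d) indep
    (U := fun j w => sqdev e (\sum_(i < n d) scale c (xi i j w))) d columns.
  - exact: (measurableT_comp (measurable_sqdev e) (column j).1).
  - exact: (has_law_comp (sqdev e) (column j).2).
  congr has_law; apply/funext => w.
  by rewrite normalized_sqnormE// n_gt0.
move=> f cf bf.
have [M fM] : exists M : R, forall x, `|f x| <= M.
  (* [bounded_fun] gives the bound only for constants strictly above [M], hence [M + 1]. *)
  by have [M [_ hM]] := bf; exists (M + 1) => x; apply: hM => //; rewrite ltrDl.
have mf := measurable_continuous cf.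
have clt := sum_clt mu4 mu1 mu2 n_oo cf fM.
have -> : ('E_(normal_prob 0 1)[f] = (\int[normal_prob 0 1]_x f x)%R%:E)%E.
  rewrite unlock -EFin_mean//.
  exact: (@intg_bounded _ (measurableTypeR R) _ (normal_prob 0 1) f M).
have : (\int[convoln (summand_law mu n d) d]_x f x)%:E @[d --> \oo] -->
    (\int[normal_prob 0 1]_x f x)%:E.
  by apply: cvg_EFin; [exact: nearW|exact: clt].
(* The law is identified for [d > 0], so the two sequences agree eventually. *)
apply: cvg_trans; apply: near_eq_cvg; near=> d.
have d0 : (0 < d)%N by near: d; exact: nbhs_infty_gt.
by rewrite (expectation_has_law (sqnorm_law d d0) mf fM).
Unshelve. all: by end_near. Qed.
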